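(* Let $q>5$ be an odd prime power, let $D$ be a derivation set on the line at infinity $\ell_\infty$ of $\mathrm{PG}(2,q^2)$, and let $K$ be a hyperbola with one infinite point in $D$ and the other infinite point outside $D$. Then the affine part of $K$ is not an arc in the Hall plane $\mathrm{Hall}(q^2)$ obtained from $D$; moreover, lines of the Hall plane intersect the affine part of $K$ in at most three points. If $s=\frac12(q\pm1)$ denotes the number of external points of $K$ on $D$, then the total number of triples of points of the affine part of $K$ that are collinear in the Hall plane is $2s\binom{q-s}{2}+2\binom{s}{3}$, which for $q$ large enough is roughly $7q^3/48$, so small.
   Context: $\mathrm{AG}(2,q^2)=\mathrm{PG}(2,q^2)\setminus\ell_\infty$. A derivation set $D$ is a Baer subline of $\ell_\infty$, i.e. an image under a projectivity of $\ell_\infty$ of the standard one $\{(x:y:0)\mid x,y\in\mathrm{GF}(q),\ (x,y)\neq(0,0)\}$ (where $\ell_\infty: Z=0$). The affine Hall plane $\mathrm{Hall}(q^2)$ obtained from $D$ has as points the points of $\mathrm{AG}(2,q^2)$; its lines are the ''old lines'', i.e. the affine parts of the lines of $\mathrm{PG}(2,q^2)$ other than $\ell_\infty$ whose infinite point is not in $D$, and the ''new lines'', i.e. the affine parts $B\setminus\ell_\infty$ of the Baer subplanes $B$ (subplanes of order $q$) of $\mathrm{PG}(2,q^2)$ containing $D$. For the standard $D$ the new lines are the sets $\{(a+\lambda u,b+\lambda v): u,v\in\mathrm{GF}(q)\}$ with $a,b\in\mathrm{GF}(q^2)$, $\lambda\in\mathrm{GF}(q^2)^*$. An arc is a set of points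 no three of which are collinear. Triples are unordered triples of distinct points. Conic means irreducible conic. A hyperbola is a conic of $\mathrm{PG}(2,q^2)$ having exactly two points on $\ell_\infty$ (its infinite points); its affine part is $K\setminus\ell_\infty$. A point not on $K$ is external if it lies on two tangents of $K$ and internal if it lies on no tangent of $K$.
   Formalization: The exact count is asymptotic to q^3/6 = 8q^3/48, so ''roughly 7q^3/48'' is false as an asymptotic; it is stated instead as: for all large q the number of triples differs from 7q^3/48 by at most one seventh of 7q^3/48. *)

(* Defs.v *)
From HB Require Import structures.
From mathcomp Require Import all_boot all_order all_algebra.
From mathcomp Require Export mpoly.

Set Implicit Arguments.
Unset Strict Implicit.
Unset Printing Implicit Defensive.

Import Order.TTheory GRing.Theory Num.Theory.

Section FiniteVspace.
Import VectorInternalTheory.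

HB.instance Definition _ (F : finFieldType) (vT : vectType F) :=
  [Countable of {vspace vT} by <:].
HB.instance Definition _ (F : finFieldType) (vT : vectType F) :=
  [Finite of {vspace vT} by <:].

End FiniteVspace.

(** Point-line geometries: a set of points and a set of lines, each line being
    the set of its points. *)

Section Geometry.
Variable T : finType.
Implicit Types (A pts : {set T}) (lns : {set {set T}}).

Definition collinear_triples lns A : {set {set T}} :=
  [set t : {set T} | [&& t \subset A, #|t| == 3 & [exists L in lns, t \subset L]]].

Definition is_arc lns A : bool := collinear_triples lns A == set0.

Definition projective_plane (n : nat) pts lns : bool :=
  [&& [forall L in lns, L \subset pts],
      [forall P in pts, forall R in pts, (P != R) ==>
         (#|[set L in lns | (P \in L) && (R \in L)]| == 1)],
      [forall L in lns, forall M in lns, (L != M) ==> (#|L :&: M| == 1)],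
      [exists A : {set T}, [&& A \subset pts, #|A| == 4 & is_arc lns A]]
    & [forall L in lns, #|L| == n.+1]].

(* The structure induced on B: its lines are the traces of the lines that meet
   B in at least two points. *)
Definition subplane (n : nat) lns (B : {set T}) : bool :=
  projective_plane n B [set L :&: B | L in lns & 1 < #|L :&: B|].

End Geometry.

Local Open Scope ring_scope.

(** The plane PG(2, F) on the space of row vectors (X, Y, Z). *)

Section Plane.
Variable F : finFieldType.
Local Notation V := 'rV[F]_3.

Definition point : predArgType := {U : {vspace V} | \dim U == 1%N}.

Definition lines : {set {set point}} :=
  [set [set P : point | (val P <= U)%VS] | U : {vspace V} & \dim U == 2%N].

(* The line Z = 0. *)
Definition linf : {set point} :=
  [set P : point | [forall v : V, (v \in val P) ==> (v 0 ord_max == 0)]].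

Definition affine (X : {set point}) : {set point} := X :\: linf.

(** Conics. *)

Definition irreducible_mpoly (Q : {mpoly F[3]}) : Prop :=
  Q \isn't a GRing.unit /\
  forall A B : {mpoly F[3]}, Q = A * B ->
    (A \is a GRing.unit) || (B \is a GRing.unit).

Definition zeros (Q : {mpoly F[3]}) : {set point} :=
  [set P : point | [forall v : V, (v \in val P) ==> (Q.@[fun i => v 0 i] == 0)]].

Definition conic (K : {set point}) : Prop :=
  exists Q : {mpoly F[3]},
    [/\ Q \is 2.-homog, irreducible_mpoly Q & K = zeros Q].

(* Irreducibility over F is enough here: a form that is irreducible over F but
   splits over an extension has a single zero in PG(2, F). *)
Definition hyperbola (K : {set point}) : Prop :=
  conic K /\ #|K :&: linf| = 2%N.

Definition tangents (K : {set point}) : {set {set point}} :=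
  [set L in lines | #|L :&: K| == 1%N].

Definition external (K : {set point}) (P : point) : bool :=
  (P \notin K) && (#|[set L in tangents K | P \in L]| == 2%N).

(** Derivation. In this part F has q ^ 2 elements. *)

Variable q : nat.

(* The subfield GF(q) of F. *)
Definition GFq : {pred F} := [pred x | x ^+ q == x].

(* The points (x : y : 0) with (x, y) = v *m g, where v ranges over the nonzero
   vectors of GF(q)^2: the image of the standard Baer subline under the
   projectivity of linf with matrix g. *)
Definition baer_subline (g : 'M[F]_2) : {set point} :=
  [set P : point | [exists v : 'rV[F]_2,
     [&& v != 0, v \is a mxOver GFq &
         val P == <[row_mx (v *m g) (0 : 'rV_1) : V]>%VS]]].

Definition derivation_set (D : {set point}) : Prop :=
  exists2 g : 'M[F]_2, g \in unitmx & D = baer_subline g.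

Definition old_lines (D : {set point}) : {set {set point}} :=
  [set affine L | L in lines & (L != linf) && [disjoint L :&: linf & D]].

Definition new_lines (D : {set point}) : {set {set point}} :=
  [set affine B | B : {set point} & subplane q lines B && (D \subset B)].

(* The points of the Hall plane are those of ~: linf. *)
Definition hall_lines (D : {set point}) : {set {set point}} :=
  old_lines D :|: new_lines D.

End Plane.

Definition prime_power (q : nat) : Prop :=
  exists p k : nat, [/\ prime p, (0 < k)%N & q = (p ^ k)%N].

(* F is GF(q^2), D is a derivation set and K is a hyperbola with one infinite
   point in D and the other one outside D. *)
Definition mixed_hyperbola (q : nat) (F : finFieldType)
    (D K : {set point F}) : Prop :=
  [/\ prime_power q, #|F| = (q ^ 2)%N, derivation_set q D, hyperbola K &
      exists P R : point F,
        [/\ K :&: linf F = [set P; R], P \in D & R \notin D]].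

(* Main.v *)
Require Import Defs.
From HB Require Import structures.
From mathcomp Require Import all_boot all_order all_algebra pgroup finfield.
From mathcomp Require Import ring lra zify.

(** Choose coordinates in which the affine part of K is the hyperbola [xy = k] and D consists
    of (1:0:0) and of the points [(c + t : 1 : 0)] with [t] in GF(q), where [c] is outside GF(q)
    ([mixed_frame]). The affine points of K are then [(x, k / x)], and the chord through the
    points with parameters [x] and [y] has the infinite point [(- x y / k : 1 : 0)]. It lies in D
    if and only if [x y] belongs to the set P of the [q] elements [- k (c + t)].

    Two affine points of a subplane that contains D are joined by a line that meets D, because two
    lines of the subplane meet in it ([subplane_direction]). Conversely, three points whose three
    chords meet D lie on a common new line ([three_chords_collinear], built on [baer_subplane]).
    Old lines carry no triples, because a line meets a conic in at most two points. Hence the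
    collinear triples correspond to the 3-subsets X of the nonzero elements of the field whose
    pairwise products lie in P. Such an X is determined by the set A of
    its three products and by the product [e] of its elements: [e ^ 2] is the product of A, and
    X consists of the quotients [e / a]. So every 3-subset A of P whose product is a square
    accounts for two triples and every other A for none ([card_product_triples]). Such a product
    is a square when an even number of its factors are nonsquares. The tangents from
    [(m : 1 : 0)] touch K where [x ^ 2 = - k m] ([external_infpt]), so the squares of P
    correspond to the external points of D, and the count follows.

    Four points of K on one new line would give [(xy)(zw) = (xz)(yw)] with all four products in P.
    Both sides are [k ^ 2] times a monic quadratic polynomial in [c] with roots in GF(q), and [1]
    and [c] are independent over GF(q), so the roots agree and two of the points coincide
    ([pairwise_chords_card]).

    The number [s] is found by counting squares: the elements of GF(q) are squares, so the
    squares outside GF(q) are a union of cosets of its multiplicative group, and the elements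
    [c + t] represent the cosets outside GF(q) ([card_square_shift]).

    With either value of [s] the number N of triples satisfies [q ^ 3 / 8 <= N <= q ^ 3 / 6] for
    [q >= 13]. The upper bound exceeds [7 q ^ 3 / 48] by exactly one seventh of it, while the
    number of all triples of affine points of K grows like [q ^ 6 / 6]. *)

Set Implicit Arguments.
Unset Strict Implicit.
Unset Printing Implicit Defensive.

Import Order.TTheory GRing.Theory Num.Theory.
Local Open Scope ring_scope.

(** * Squares in a finite field of odd order *)

Lemma card_nth_roots (F : finFieldType) (n : nat) (y : F) :
  (0 < n)%N -> (#|[set x : F | (x ^+ n == y)%R]| <= n)%N.
Proof.
move=> n_gt0; have sz : size ('X^n - y%:P) = n.+1 by rewrite size_XnsubC.
rewrite -ltnS -sz cardE; apply: max_poly_roots; last exact: enum_uniq.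
  by rewrite -size_poly_eq0 sz.
by apply/allP=> x; rewrite mem_enum inE /root !hornerE subr_eq0.
Qed.

Section Squares.
Variable F : finFieldType.
Hypothesis oddF : odd #|F|.

Definition is_square (x : F) : bool := [exists e, e ^+ 2 == x].

Lemma two_neq0 : (2 : F) != 0.
Proof.
apply/eqP=> two0; have ch2 : 2%N \in [pchar F] by rewrite inE /= two0 eqxx.
have := pprimeChar_pgroup ch2; rewrite /pgroup cardsT => /p_natP[n cF].
have : odd #|F| && (1 < #|F|)%N by rewrite oddF finNzRing_gt1.
by rewrite cF oddX orbF => /andP[/eqP->].
Qed.

Lemma oppr_neq (e : F) : e != 0 -> - e != e.
Proof.
move=> e0; rewrite -subr_eq0 -opprD oppr_eq0 -mulr2n -mulr_natr mulf_neq0 //.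
exact: two_neq0.
Qed.

Lemma card_sqrt (x : F) : x != 0 ->
  #|[set e : F | e ^+ 2 == x]| = (if is_square x then 2 else 0)%N.
Proof.
move=> x0; case: ifPn => [/existsP[e /eqP xE]|nsq].
  have e0 : e != 0 by apply: contraNneq x0 => e0; rewrite -xE e0 expr0n.
  have -> : [set z : F | z ^+ 2 == x] = [set e; - e].
    by apply/setP=> z; rewrite !inE -xE eqf_sqr.
  by rewrite cards2 eq_sym oppr_neq.
apply/eqP; rewrite cards_eq0; apply/set0Pn=> -[e]; rewrite inE => ee.
by case/negP: nsq; apply/existsP; exists e.
Qed.

(** Squaring is two-to-one on the nonzero elements. *)
Lemma card_squares : #|[set x : F | (x != 0) && (is_square x)]| = #|F|.-1./2.
Proof.
have cF0 : #|[set e : F | e != 0]| = #|F|.-1.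
  by rewrite -(cardC1 (0 : F)); apply: eq_card => x; rewrite !inE.
suff -> : #|F|.-1 = double #|[set x : F | (x != 0) && (is_square x)]| by rewrite doubleK.
rewrite -cF0 -sum1dep_card.
rewrite (partition_big (fun e => e ^+ 2) (fun x => x != 0)) /=; last first.
  by move=> e e0; rewrite expf_neq0.
rewrite -muln2 -sum1dep_card big_distrl /= big_mkcondr /=.
apply: eq_bigr => x x0; rewrite -card_sqrt // -sum1dep_card.
apply: eq_bigl => e; apply: andb_idl => /eqP ex.
by apply: contraNneq x0 => e0; rewrite -ex e0 expr0n.
Qed.

(** Euler's criterion: the nonzero squares are roots of [X^m - 1] with [m = (#|F| - 1) / 2],
    and by [card_squares] there are already [m] of them. *)
Lemma squareE (x : F) : x != 0 -> (is_square x) = (x ^+ #|F|.-1./2 == 1).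
Proof.
move=> x0; have m0 : (0 < #|F|.-1./2)%N.
  by move: oddF (finNzRing_gt1 F); case: #|F| => [|[|[]]].
have cFm : (#|F|.-1./2 * 2)%N = #|F|.-1.
  by rewrite muln2 halfK; move: oddF; case: #|F| => //= n /negbTE->; rewrite subn0.
have sub : [set y : F | (y != 0) && (is_square y)] \subset
  [set y : F | y ^+ #|F|.-1./2 == 1].
  apply/subsetP=> y; rewrite !inE => /andP[y0 /existsP[e /eqP ye]].
  have e0 : e != 0 by apply: contraNneq y0 => e0; rewrite -ye e0 expr0n.
  rewrite -ye -exprM mulnC cFm; apply/eqP/(mulfI e0).
  by rewrite -exprS prednK ?expf_card ?mulr1 // (ltn_trans _ (finNzRing_gt1 F)).
have := eqEcard [set y : F | (y != 0) && (is_square y)] [set y : F | y ^+ #|F|.-1./2 == 1].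
rewrite sub card_squares card_nth_roots // => /eqP/setP/(_ x).
by rewrite !inE x0.
Qed.

Lemma square_char (x : F) : x != 0 ->
  x ^+ #|F|.-1./2 = (-1) ^+ (~~ is_square x).
Proof.
move=> x0; rewrite squareE //; case: eqP => //= /eqP xm; apply/eqP.
have cFm : (#|F|.-1./2 * 2)%N = #|F|.-1.
  by rewrite muln2 halfK; move: oddF; case: #|F| => //= n /negbTE->; rewrite subn0.
have : (x ^+ #|F|.-1./2) ^+ 2 == 1 ^+ 2.
  rewrite -exprM cFm expr1n; apply/eqP/(mulfI x0).
  by rewrite -exprS prednK ?expf_card ?mulr1 // (ltn_trans _ (finNzRing_gt1 F)).
by rewrite eqf_sqr (negbTE xm).
Qed.

Lemma signr_eq1 (b : nat) : ((-1) ^+ b == 1 :> F) = ~~ odd b.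
Proof.
rewrite -signr_odd; case: (odd b); rewrite ?eqxx //= expr1.
by rewrite (negbTE (oppr_neq (oner_neq0 _))).
Qed.

Lemma squareM (x y : F) : x != 0 -> y != 0 ->
  is_square (x * y) = (is_square x == is_square y).
Proof.
move=> x0 y0; rewrite [LHS]squareE ?mulf_neq0 // exprMn !square_char //.
by rewrite -signr_addb signr_eq1; case: is_square; case: is_square.
Qed.

(** The quadratic character is multiplicative, so every nonsquare factor flips it. *)
Lemma square_prod (A : {set F}) : 0 \notin A ->
  is_square (\prod_(a in A) a) = ~~ odd #|[set a in A | ~~ is_square a]|.
Proof.
move=> A0; have nz a : a \in A -> a != 0 by apply: contraTneq => ->.
rewrite squareE; last by apply/prodf_neq0.
rewrite -prodrXl (eq_bigr _ (fun a aA => square_char (nz a aA))).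
rewrite -expr_sum signr_eq1 -sum1dep_card big_mkcondr.
by congr (~~ odd _).
Qed.
End Squares.

(** * Triples with prescribed pairwise products *)

Section Draws.
Variable T : finType.
Implicit Types A B C N S : {set T}.

(** A subset of a disjoint union is the same as a pair of subsets. *)
Lemma card_draws_split B C i j : [disjoint B & C] ->
  #|[set A : {set T} | [&& A \subset B :|: C, #|A :&: B| == i & #|A :&: C| == j]]|
  = ('C(#|B|, i) * 'C(#|C|, j))%N.
Proof.
move=> dBC; rewrite -!cards_draws -cardsX.
have BC0 : B :&: C = set0 by apply/eqP; rewrite setI_eq0.
rewrite -(@card_in_imset _ _ (fun P : {set T} * {set T} => P.1 :|: P.2)).
  apply: eq_card => A; rewrite !inE; apply/and3P/imsetP.
    case=> AS Ai Aj; exists (A :&: B, A :&: C); rewrite ?inE /= ?subsetIr ?Ai ?Aj //.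
    by rewrite -setIUr (setIidPl AS).
  case=> -[X Y]; rewrite !inE /= => /andP[/andP[XB Xi] /andP[YC Yj]] ->.
  have XC : X :&: C = set0 by apply/eqP; rewrite -subset0 -BC0 setSI.
  have YB : Y :&: B = set0 by apply/eqP; rewrite -subset0 -BC0 setIC setIS.
  by rewrite setUSS // !setIUl (setIidPl XB) (setIidPl YC) XC YB setU0 set0U.
move=> [X Y] [X' Y'] /=; rewrite !inE /=.
move=> /andP[/andP[XB Xi] /andP[YC Yj]] /andP[/andP[XB' Xi'] /andP[YC' Yj']] /setP E.
by congr pair; apply/setP=> x; have := E x; have /subsetP/(_ x) := XB;
  have /subsetP/(_ x) := YC; have /subsetP/(_ x) := XB'; have /subsetP/(_ x) := YC';
  have /setP/(_ x) := BC0; rewrite !inE; do !case: (x \in _) => //=;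
  do ?[move/(_ isT)=> //]; move=> *; intuition.
Qed.
End Draws.

Lemma cards3_pick (T : finType) (A : {set T}) (a b : T) :
  #|A| = 3%N -> a \in A -> b \in A -> a != b ->
  exists c, [/\ c \in A, c != a, c != b & A = [set a; b; c]].
Proof.
move=> cA aA bA ab; have : #|A :\ a :\ b| == 1%N.
  have cAa : #|A :\ a| = 2%N by move: cA; rewrite (cardsD1 a) aA => -[].
  by move: cAa; rewrite (cardsD1 b) !inE [b == a]eq_sym ab bA add1n => -[->].
case/cards1P=> c Ac; have : c \in A :\ a :\ b by rewrite Ac set11.
rewrite !inE => /and3P[cb ca cA']; exists c; split=> //.
apply/setP=> x; have /setP/(_ x) := Ac; rewrite !inE.
have [->|_] := eqVneq x a; first by rewrite aA.
by have [->|_] := eqVneq x b; first by rewrite bA.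
Qed.

Section Triples.
Variable F : finFieldType.
Variable S : {set F}.

Definition product_triples : {set {set F}} :=
  [set X : {set F} | (#|X| == 3%N) &&
     [forall x in X, forall y in X, (x != y) ==> (x * y \in S)]].

(** Pairs of a 3-subset of [S] and a square root of its product; through [quotients] they
    parametrize [product_triples]. *)
Definition root_triples : {set F * {set F}} :=
  [set P : F * {set F} | [&& P.2 \subset S, #|P.2| == 3%N
                           & P.1 ^+ 2 == \prod_(a in P.2) a]].

Definition quotients (P : F * {set F}) : {set F} := [set P.1 / a | a in P.2].

Hypothesis S0 : 0 \notin S.

Lemma root_triples_neq0 P : P \in root_triples ->
  P.1 != 0 /\ {in P.2, forall a, a != 0}.
Proof.
rewrite inE => /and3P[AS _ /eqP eA].
have nz : {in P.2, forall a, a != 0}.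
  by move=> a aA; apply: contraNneq S0 => <-; apply: (subsetP AS).
split=> //; have : P.1 ^+ 2 != 0 by rewrite eA; apply/prodf_neq0.
by rewrite expf_eq0.
Qed.

Lemma divl_inj (e : F) : e != 0 -> injective (fun a => e / a).
Proof. by move=> e0 a b /(mulfI e0)/invr_inj. Qed.

Lemma prod_quotients P : P \in root_triples -> \prod_(x in quotients P) x = P.1.
Proof.
move=> PT; have [e0 nz] := root_triples_neq0 PT.
rewrite big_imset; last by move=> a b _ _; apply: divl_inj.
rewrite big_split /= prodr_const prodfV.
move: PT; rewrite inE => /and3P[_ /eqP-> /eqP<-].
by rewrite exprS -mulrA divff ?mulr1 // expf_neq0.
Qed.

Lemma quotients_inj : {in root_triples &, injective quotients}.
Proof.
move=> P P' PT PT' PP'; have [e0 _] := root_triples_neq0 PT.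
have E1 : P.1 = P'.1 by rewrite -(prod_quotients PT) PP' prod_quotients.
have E2 : P.2 = P'.2.
  apply: (imset_inj (divl_inj e0)).
  by move: PP'; rewrite /quotients -E1.
by case: P P' {PT PT' PP' e0} E1 E2 => [e A] [e' A'] /= -> ->.
Qed.

(** The inverse of [quotients] sends X to the pair of its product [e] and the set of the
    quotients [e / x], which are the products of the other two elements of X. *)
Lemma product_triplesE : product_triples = quotients @: root_triples.
Proof.
apply/setP=> X; apply/idP/imsetP.
  rewrite inE => /andP[/eqP cX /'forall_implyP XS].
  have {}XS x y : x \in X -> y \in X -> x != y -> x * y \in S.
    by move=> xX yX; have /'forall_implyP/(_ y yX)/implyP := XS x xX.
  pose e := \prod_(x in X) x.
  have other x : x \in X -> exists y, (y \in X) && (y != x).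
    move=> xX; have /card_gt0P[y] : (0 < #|X :\ x|)%N.
      by have := cardsD1 x X; rewrite xX cX add1n => -[<-].
    by rewrite !inE andbC; exists y.
  have eS x : x \in X -> x != 0 /\ e / x \in S.
    move=> xX; have [y /andP[yX yx]] := other x xX.
    have [z [zX zx zy XE]] : exists z, [/\ z \in X, z != x, z != y & X = [set x; y; z]].
      by apply: cards3_pick => //; rewrite eq_sym.
    have x0 : x != 0.
      by apply: contraNneq S0 => x0; have := XS _ _ xX yX; rewrite x0 mul0r eq_sym -x0; apply.
    split=> //; have -> : e / x = y * z.
      rewrite /e {1}XE -setUA big_setU1 ?inE ?negb_or ?[x == _]eq_sym ?yx ?zx //=.
      rewrite big_setU1 ?inE 1?[y == _]eq_sym // big_set1.
      by rewrite mulrAC mulfV ?mul1r.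
    by apply: XS => //; rewrite eq_sym.
  have e0 : e != 0 by apply/prodf_neq0=> x /eS[].
  have EX : X = quotients (e, [set e / x | x in X]).
    rewrite /quotients /= -imset_comp -[LHS]imset_id; apply: eq_in_imset => x xX /=.
    by rewrite invf_div mulrC divfK.
  exists (e, [set e / x | x in X]) => //; rewrite inE /= card_imset; last exact: divl_inj.
  rewrite cX eqxx /=; apply/andP; split.
    by apply/subsetP=> a /imsetP[x /eS[_ ?] ->].
  rewrite big_imset; last by move=> a b _ _; apply: divl_inj.
  by rewrite big_split /= prodr_const prodfV -/e cX [e ^+ 3]exprSr mulfK.
case=> P PT ->; have [e0 nz] := root_triples_neq0 PT.
have := PT; rewrite !inE => /and3P[AS /eqP cA /eqP eA].
rewrite card_imset ?cA ?eqxx /=; last exact: divl_inj.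
apply/'forall_implyP=> _ /imsetP[a aA ->]; apply/'forall_implyP=> _ /imsetP[b bA ->].
apply/implyP=> ab; have {}ab : a != b by apply: contraNneq ab => ->.
have [c [cA' ca cb AE]] := cards3_pick cA aA bA ab.
have -> : P.1 / a * (P.1 / b) = c.
  rewrite mulrACA -expr2 eA {1}AE -setUA big_setU1 ?inE ?negb_or ?ab 1?eq_sym ?ca //=.
  rewrite big_setU1 ?inE 1?eq_sym // big_set1.
  by rewrite /=; field; rewrite !nz.
exact: (subsetP AS).
Qed.

Hypothesis oddF : odd #|F|.

(** A 3-subset of [S] has zero or two square roots of its product, and two exactly when it
    contains an even number of nonsquares: none, or two of them. *)
Lemma card_product_triples
    (s := #|[set a in S | is_square a]|) (n := #|[set a in S | ~~ is_square a]|) :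
  #|product_triples| = (2 * s * 'C(n, 2) + 2 * 'C(s, 3))%N.
Proof.
rewrite product_triplesE card_in_imset; last exact: quotients_inj.
pose Q := [set a in S | is_square a]; pose N := [set a in S | ~~ is_square a].
have dQN : [disjoint Q & N].
  by rewrite -setI_eq0; apply/eqP/setP=> x; rewrite !inE; case: (x \in S); case: is_square.
have SE : S = Q :|: N.
  by apply/setP=> x; rewrite !inE -andb_orr orbN andbT.
have AN (A : {set F}) : A \subset S -> [set a in A | ~~ is_square a] = A :&: N.
  move=> AS; apply/setP=> x; rewrite !inE; case xA: (x \in A) => //=.
  by rewrite (subsetP AS).
have cAS (A : {set F}) : A \subset S -> #|A| = (#|A :&: Q| + #|A :&: N|)%N.
  move=> AS; rewrite -cardsUI [A :&: Q :&: _](_ : _ = set0) ?cards0 ?addn0.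
    by rewrite -setIUr -SE (setIidPl AS).
  apply/setP=> x; rewrite !inE; case: (is_square x); rewrite /= ?andbF //.
have -> : #|root_triples| = (\sum_(A : {set F} | (A \subset S) && (#|A| == 3%N))
    #|[set e : F | e ^+ 2 == (\prod_(a in A) a)%R]|)%N.
  rewrite -sum1_card (partition_big snd (fun A : {set F} => (A \subset S) && (#|A| == 3%N))) /=.
    apply: eq_bigr => A /andP[AS cA].
    rewrite -(card_imset _ (f := fun e => (e, A))); last by move=> ? ? [].
    rewrite sum1_card; apply: eq_card => -[e B]; rewrite unfold_in /=.
    rewrite inE /=; apply/andP/imsetP.
      by case=> /and3P[_ _ eB] /eqP BA; exists e; rewrite ?inE -?BA.
    by case=> _ /[swap] -[<- ->]; rewrite inE AS cA.
  by move=> P; rewrite inE => /and3P[-> ->].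
transitivity (\sum_(A : {set F} | ((A \subset S) && (#|A| == 3%N)) && ~~ odd #|A :&: N|) 2)%N.
  rewrite [RHS]big_mkcondr; apply: eq_bigr => A /andP[AS _].
  have A0 : 0 \notin A by apply: contraNN S0 => /(subsetP AS).
  rewrite card_sqrt ?square_prod ?AN //; apply/prodf_neq0 => a aA.
  by apply: contraNneq A0 => <-.
rewrite sum_nat_cond_const.
have -> : #|[set A : {set F} | ((A \subset S) && (#|A| == 3%N)) && ~~ odd #|A :&: N|]|
  = #|[set A : {set F} | [&& A \subset Q :|: N, #|A :&: Q| == 1%N & #|A :&: N| == 2%N]]
     :|: [set A : {set F} | [&& A \subset Q :|: N, #|A :&: Q| == 3%N & #|A :&: N| == 0%N]]|.
  apply: eq_card => A; rewrite !inE -SE; case AS: (A \subset S) => //=.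
  rewrite cAS //; move: #|A :&: Q| #|A :&: N| => i j.
  by case: j i => [|[|[|[|j]]]] [|[|[|[|i]]]].
rewrite cardsU (_ : _ :&: _ = set0).
  rewrite cards0 subn0 !card_draws_split // bin0 bin1 muln1 mulnC mulnDr.
  by rewrite -/s -/n [(2 * s)%N]mulnC -mulnA mulnCA mulnA.
apply/setP=> A; rewrite !inE; case: (A \subset _) => //=.
by move: #|A :&: Q| => [|[|i]] //=; rewrite ?andbF.
Qed.
End Triples.

(** * The subfield of order q *)

Section Subfield.
Variables (q : nat) (F : finFieldType).
Hypothesis (ppq : prime_power q) (cardF : #|F| = (q ^ 2)%N).
Local Notation GFq := (@GFq F q).

Lemma q_gt1 : (1 < q)%N.
Proof. by have := finNzRing_gt1 F; rewrite cardF; case: q => [|[|]]. Qed.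

Let q_gt0 : (0 < q)%N. Proof. exact: ltnW q_gt1. Qed.

Lemma GFqE x : (x \in GFq) = (x ^+ q == x). Proof. by []. Qed.

Lemma frobeniusD (x y : F) : (x + y) ^+ q = x ^+ q + y ^+ q.
Proof.
have [p [k [pp k0 qE]]] := ppq; apply: exprDn_pchar.
have chp : p \in [pchar F].
  by apply: (@card_finPcharP F p (k * 2)) => //; rewrite cardF qE expnM.
by rewrite qE (eq_pnat _ (pcharf_eq chp)) pnatX pnat_id.
Qed.

Lemma frobeniusK (x : F) : (x ^+ q) ^+ q = x.
Proof. by rewrite -exprM mulnn -cardF expf_card. Qed.

Lemma frobeniusN (x : F) : (- x) ^+ q = - x ^+ q.
Proof. by apply: (addrI (x ^+ q)); rewrite -frobeniusD !subrr expr0n gtn_eqF. Qed.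

Lemma GFq0 : 0 \in GFq. Proof. by rewrite GFqE expr0n gtn_eqF. Qed.
Lemma GFq1 : 1 \in GFq. Proof. by rewrite GFqE expr1n. Qed.
Lemma GFqD : {in GFq &, forall x y, x + y \in GFq}.
Proof. by move=> x y; rewrite !GFqE frobeniusD => /eqP-> /eqP->. Qed.
Lemma GFqN : {in GFq, forall x, - x \in GFq}.
Proof. by move=> x; rewrite !GFqE frobeniusN => /eqP->. Qed.
Lemma GFqB : {in GFq &, forall x y, x - y \in GFq}.
Proof. by move=> x y xG yG; rewrite GFqD ?GFqN. Qed.
Lemma GFqM : {in GFq &, forall x y, x * y \in GFq}.
Proof. by move=> x y; rewrite !GFqE exprMn => /eqP-> /eqP->. Qed.
Lemma GFqV : {in GFq, forall x, x^-1 \in GFq}.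
Proof. by move=> x; rewrite !GFqE exprVn => /eqP->. Qed.

Lemma GFq_unit (x : F) : x != 0 -> (x \in GFq) = (x ^+ q.-1 == 1).
Proof.
move=> x0; rewrite GFqE -[q in LHS](prednK q_gt0) exprS -[X in (_ == X) = _]mulr1.
by rewrite (inj_eq (mulfI x0)).
Qed.

(** Nonzero elements of GF(q) are roots of [X^(q-1) - 1], which bounds their number from above;
    the fibres of the norm bound it from below. *)
Lemma card_GFq : #|[set x in GFq]| = q.
Proof.
pose G := [set x : F | (x != 0) && (x \in GFq)].
have GE : #|[set x in GFq]| = #|G|.+1.
  rewrite (cardsD1 0) inE GFq0 add1n; congr _.+1.
  by apply: eq_card => x; rewrite !inE.
apply/eqP; rewrite GE -[X in _ == X](prednK q_gt0) eqSS eqn_leq; apply/andP; split.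
  have q1 : (0 < q.-1)%N by rewrite -ltnS prednK ?q_gt1.
  apply: leq_trans (card_nth_roots (1 : F) q1); apply: subset_leq_card.
  by apply/subsetP=> x; rewrite !in_set => /andP[x0]; rewrite GFq_unit.
(* The norm [x -> x ^ (q + 1)] maps the nonzero elements into GF(q), at most [q + 1] to one. *)
rewrite -(@leq_pmul2r q.+1) //.
have -> : (q.-1 * q.+1)%N = #|[set x : F | x != 0]|.
  have -> : #|[set x : F | x != 0]| = #|F|.-1.
    by rewrite -(cardC1 (0 : F)); apply: eq_card => x; rewrite !inE.
  by rewrite cardF; move: q_gt0; case: (q) => // n _ /=; lia.
rewrite -sum1dep_card (partition_big (fun x => x ^+ q.+1) [in G]) /=.
  rewrite -sum_nat_const; apply: leq_sum => y _.
  apply: leq_trans (card_nth_roots y (ltn0Sn q)).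
  rewrite sum1dep_card; apply: subset_leq_card; apply/subsetP=> x.
  by rewrite !inE => /andP[].
move=> x x0; rewrite !inE expf_neq0 //= -exprM mulnC exprM exprS.
by rewrite frobeniusK mulrC -exprS.
Qed.

Hypothesis oddq : odd q.

Lemma odd_cardF : odd #|F|. Proof. by rewrite cardF oddX oddq orbT. Qed.

(** [q - 1] divides [(q ^ 2 - 1) / 2], so Euler's criterion applies. *)
Lemma GFq_square (x : F) : x \in GFq -> is_square x.
Proof.
have [-> _|x0] := eqVneq x 0; first by apply/existsP; exists 0; rewrite expr0n.
rewrite GFq_unit // => /eqP xq; rewrite (squareE odd_cardF) // cardF.
have -> : ((q ^ 2).-1./2 = q.-1 * q.+1./2)%N.
  have := odd_double_half q; rewrite oddq; move: (q./2) => m <-.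
  have -> : ((true + m.*2) ^ 2).-1 = (m.*2 * m.+1).*2 by rewrite -!muln2 -mulnn /=; lia.
  by rewrite doubleK -doubleS doubleK.
by rewrite exprM xq expr1n.
Qed.

Lemma square_GFqM (u x : F) : u \in GFq -> u != 0 -> is_square (u * x) = is_square x.
Proof.
move=> uG u0; have /existsP[e /eqP eu] := GFq_square uG.
have e0 : e != 0 by apply: contraNneq u0 => e0; rewrite -eu e0 expr0n.
apply/existsP/existsP => -[f /eqP fE].
  by exists (f / e); rewrite expr_div_n fE eu mulrAC divff ?mul1r.
by exists (e * f); rewrite exprMn eu fE.
Qed.

Variable c : F.
Hypothesis cG : c \notin GFq.

Lemma GFq_lin_eq0 u v : u \in GFq -> v \in GFq -> u * c + v = 0 -> u = 0 /\ v = 0.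
Proof.
move=> uG vG E; have [u0|u0] := eqVneq u 0; first by move: E; rewrite u0 mul0r add0r.
case/negP: cG; have -> : c = - (u^-1 * v).
  by apply/(mulfI u0); apply/eqP; rewrite -subr_eq0 mulrN mulVKf // opprK E.
by rewrite GFqN // GFqM // GFqV.
Qed.

Lemma GFq_lin_inj u v u' v' : u \in GFq -> v \in GFq -> u' \in GFq -> v' \in GFq ->
  u * c + v = u' * c + v' -> u = u' /\ v = v'.
Proof.
move=> uG vG uG' vG' E; have [] := @GFq_lin_eq0 (u - u') (v - v').
- exact: GFqB. 
- exact: GFqB. 
- by rewrite mulrBl addrACA E -opprD subrr.
by move=> /subr0_eq-> /subr0_eq->.
Qed.

Lemma addc_neq0 t : t \in GFq -> c + t != 0.
Proof.
move=> tG; apply: contraNneq cG => /eqP; rewrite addr_eq0 => /eqP->.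
exact: GFqN.
Qed.

(** The elements outside GF(q) are the products [u (c + t)] with [u] nonzero in GF(q), and
    [u] is a square. So the [(q ^ 2 - 1) / 2] nonzero squares are the [q - 1] elements [u]
    together with [q - 1] multiples of each square [c + t]. *)
Lemma card_square_shift :
  #|[set t : F | (t \in GFq) && is_square (c + t)]| = (q - 1)./2.
Proof.
pose U := [set u : F | (u != 0) && (u \in GFq)].
have cU : #|U| = (q - 1)%N.
  have := card_GFq; rewrite (cardsD1 0) inE GFq0 => <-; rewrite addKn.
  by apply: eq_card => x; rewrite !inE.
(* The pairs [(u, t)] run over the elements [u (c + t)] outside GF(q), each met once. *)
have scale_inj : {in setX U [set t in GFq] &, injective (fun P => P.1 * (c + P.2))}.
  move=> [u t] [u' t']; rewrite !in_set /= => /andP[/andP[u0 uG] tG] /andP[/andP[u0' uG'] tG'].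
  rewrite !mulrDr => E; have [||||uu tt] := GFq_lin_inj _ _ _ _ E; rewrite ?GFqM //.
  by rewrite -uu in tt *; rewrite (mulfI u0 tt).
have sub : [set P.1 * (c + P.2) | P in setX U [set t in GFq]] \subset [set x : F | x \notin GFq].
  apply/subsetP=> x /imsetP[[u t]]; rewrite !in_set /= => /andP[/andP[u0 uG] tG] ->.
  apply: contra cG => utG; have -> : c = u * (c + t) / u - t by rewrite mulrAC divff // mul1r addrK.
  exact: GFqB (GFqM utG (GFqV uG)) tG.
have cN : #|[set x : F | x \notin GFq]| = (q * (q - 1))%N.
  have := cardsC [set x in GFq]; rewrite card_GFq cardF => E.
  have -> : #|[set x | x \notin GFq]| = #|~: [set x in GFq]| by apply: eq_card => x; rewrite !inE.
  by move: E; set k := #|_|; have := q_gt0; case: (q) => // n _; lia.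
have surj : [set P.1 * (c + P.2) | P in setX U [set t in GFq]] = [set x : F | x \notin GFq].
  apply/eqP; rewrite eqEcard sub cN card_in_imset // cardsX cU card_GFq mulnC leqnn //.
have := card_squares odd_cardF.
have -> : [set x : F | (x != 0) && is_square x] =
  U :|: [set P.1 * (c + P.2) | P in setX U [set t in GFq | is_square (c + t)]].
  apply/setP=> x; rewrite inE [RHS]in_setU [x \in U]in_set.
  case xG: (x \in GFq).
    rewrite andbT GFq_square // andbT; case: eqP => //= _; apply/esym/negbTE.
    apply/negP=> /imsetP[[u t]]; rewrite !in_set /= => /and3P[uG tG _] E.
    have : x \in [set x : F | x \notin GFq].
      by rewrite -surj E; apply/imsetP; exists (u, t); rewrite // !in_set /= uG.
    by rewrite inE xG.
  rewrite andbF /=; have x0 : x != 0 by apply: contraFneq xG => ->; rewrite GFq0.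
  rewrite x0 /=; have : x \in [set x : F | x \notin GFq] by rewrite in_set xG.
  rewrite -surj => /imsetP[[u t]]; rewrite !in_set /= => /andP[uG tG] E.
  have /andP[u0 uG'] := uG.
  rewrite E square_GFqM //; apply/idP/imsetP=> [sq|].
    by exists (u, t); rewrite // !in_set /= uG tG.
  case=> -[u' t']; rewrite !in_set /= => /and3P[uG'' tG' sq] E'.
  suff [_ <-] : (u', t') = (u, t) by [].
  by apply: scale_inj => //; rewrite !in_set /= ?uG ?uG''.
rewrite cardsU card_in_imset; last first.
  move=> P P'; rewrite !in_set => /and3P[uG tG _] /and3P[uG' tG' _]; apply: scale_inj;
  by rewrite !in_set ?uG ?uG'.
rewrite cardsX (_ : _ :&: _ = set0) ?cards0 ?subn0.
  rewrite cU cardF; set k := #|_|; have := oddq; have := q_gt1.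
  case: (q) => // n; rewrite ltnS subSS subn0 => n0 on E.
  have : (n * (2 * (1 + k)) = n * n.+2)%N by move: E; have := on; lia.
  by move/eqP; rewrite eqn_pmul2l // => /eqP; lia.
apply/eqP; rewrite setI_eq0; apply/pred0P=> x /=; apply/negP=> /andP[].
rewrite in_set => /andP[_ xG] /imsetP[[u t]]; rewrite !in_set /= => /and3P[uG tG _] E.
have : x \in [set x : F | x \notin GFq].
  by rewrite -surj E; apply/imsetP; exists (u, t); rewrite // !in_set /= uG.
by rewrite inE xG.
Qed.

(** Multiplication by a nonsquare exchanges the squares and the nonsquares among the [q]
    elements [c + t], of which [(q - 1) / 2] are squares. *)
Lemma card_square_scaled (k : F) : k != 0 ->
  let s := #|[set t : F | (t \in GFq) && is_square (k * (c + t))]| in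
  s = ((q - 1)./2)%N \/ s = ((q + 1)./2)%N.
Proof.
move=> k0 s; rewrite {}/s.
have oF := odd_cardF; have c0 := addc_neq0.
case sk: (is_square k).
  left; rewrite -card_square_shift; apply: eq_card => t; rewrite !inE.
  by case tG: (_ == _) => //=; rewrite squareM ?sk ?c0.
right; have := cardsID [set t | is_square (c + t)] [set t in GFq].
rewrite card_GFq (_ : #|_ :&: _| = (q - 1)./2); last first.
  by rewrite -card_square_shift; apply: eq_card => t; rewrite !inE.
rewrite (_ : #|_ :\: _| = #|[set t : F | (t \in GFq) && is_square (k * (c + t))]|).
  set n := #|_|; have := odd_double_half q; rewrite oddq; move: (q./2) => m <-.
  by rewrite add1n subn1 addn1 -doubleS !doubleK; lia.
apply: eq_card => t; rewrite !inE.
case tG: (_ == _); rewrite ?andbF ?andbT //=.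
by rewrite squareM ?sk ?c0 //; case: is_square.
Qed.
End Subfield.

(** * Points and lines in homogeneous coordinates *)

Section Points.
Variable F : finFieldType.
Local Notation V := 'rV[F]_3.
Implicit Types (u v w : V) (U W : {vspace V}) (P R : point F) (L : {set point F}).

Definition vec (x y z : F) : V := \row_(i < 3) [:: x; y; z]`_i.

Lemma vecE u : u = vec (u 0 0) (u 0 1) (u 0 ord_max).
Proof.
apply/rowP=> -[[|[|[|]]] //= i]; rewrite mxE /=; congr (u 0 _); exact: val_inj.
Qed.

Lemma vec_coord x y z :
  (vec x y z 0 0 = x) * (vec x y z 0 1 = y) * (vec x y z 0 ord_max = z).
Proof. by rewrite !mxE. Qed.

Lemma vec_inj x y z x' y' z' : vec x y z = vec x' y' z' -> [/\ x = x', y = y' & z = z'].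
Proof.
move=> E; have E1 := congr1 (fun u : V => u 0 0) E.
have E2 := congr1 (fun u : V => u 0 1) E; have E3 := congr1 (fun u : V => u 0 ord_max) E.
by move: E1 E2 E3; rewrite !vec_coord.
Qed.

Lemma vec_lin a b x y z x' y' z' :
  a *: vec x y z + b *: vec x' y' z' =
  vec (a * x + b * x') (a * y + b * y') (a * z + b * z').
Proof. by apply/rowP=> -[[|[|[|]]] //= i]; rewrite !mxE. Qed.

Lemma vecD x y z x' y' z' :
  vec x y z + vec x' y' z' = vec (x + x') (y + y') (z + z').
Proof. by apply/rowP=> -[[|[|[|]]] //= i]; rewrite !mxE. Qed.

Lemma vec_scale a x y z : a *: vec x y z = vec (a * x) (a * y) (a * z).
Proof. by apply/rowP=> -[[|[|[|]]] //= i]; rewrite !mxE. Qed.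

Lemma vec_eq0 x y z : (vec x y z == 0) = [&& x == 0, y == 0 & z == 0].
Proof.
apply/eqP/and3P => [E|[/eqP-> /eqP-> /eqP->]].
  have [] : [/\ x = 0, y = 0 & z = 0].
    by apply: vec_inj; rewrite E; apply/rowP=> -[[|[|[|]]] //= i]; rewrite !mxE.
  by move=> -> -> ->.
by apply/rowP=> -[[|[|[|]]] //= i]; rewrite !mxE.
Qed.

Fact pt_default_subproof : \dim <[vec 0 0 1]> == 1%N.
Proof. by rewrite dim_vline vec_eq0 !eqxx oner_eq0. Qed.

(** The point spanned by [v]; the default of [insubd] is reached only at [v = 0]. *)
Definition pt v : point F :=
  insubd (exist (fun U : {vspace V} => \dim U == 1%N) _ pt_default_subproof) <[v]>%VS.

Lemma val_pt v : v != 0 -> val (pt v) = <[v]>%VS.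
Proof. by move=> v0; rewrite val_insubd dim_vline v0. Qed.

Lemma ptP P : exists2 v, v != 0 & P = pt v.
Proof.
have dP := valP P; exists (vpick (val P)).
  by rewrite vpick0 -dimv_eq0 (eqP dP).
have v0 : vpick (val P) != 0 by rewrite vpick0 -dimv_eq0 (eqP dP).
apply: val_inj; rewrite val_pt //; apply/esym/eqP.
by rewrite eqEdim (eqP dP) dim_vline v0 -memvE memv_pick.
Qed.

Lemma pt_val P v : val P = <[v]>%VS -> P = pt v.
Proof.
move=> E; apply: val_inj; rewrite val_pt //; apply: contraTneq (valP P) => v0.
by rewrite /= E v0 dim_vline eqxx.
Qed.

Lemma eq_pt v w : v != 0 -> w != 0 -> pt v = pt w <-> exists2 a, a != 0 & v = a *: w.
Proof.
move=> v0 w0; split=> [/(congr1 val)|[a a0 E]].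
  rewrite !val_pt // => E; have /vlineP[a vE] : v \in <[w]>%VS by rewrite -E memv_line.
  by exists a => //; apply: contraNneq v0 => a0; rewrite vE a0 scale0r.
apply: val_inj; rewrite !val_pt //; apply/eqP; rewrite eqEdim !dim_vline v0 w0 leqnn andbT.
by rewrite -memvE E memvZ // memv_line.
Qed.

Lemma ptZ a v : a != 0 -> pt (a *: v) = pt v.
Proof.
move=> a0; have [->|v0] := eqVneq v 0; first by rewrite scaler0.
by apply/eq_pt=> //; [rewrite scaler_eq0 negb_or a0 | exists a].
Qed.

Definition line_of U : {set point F} := [set P : point F | (val P <= U)%VS].

Lemma mem_line_of v U : v != 0 -> (pt v \in line_of U) = (v \in U).
Proof. by move=> v0; rewrite inE val_pt // memvE. Qed.

Lemma linesP L : reflect (exists2 U, \dim U = 2%N & L = line_of U) (L \in lines F).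
Proof.
apply: (iffP imsetP) => [[U]|[U dU ->]]; first by rewrite inE => /eqP dU ->; exists U.
by exists U; rewrite ?inE ?dU.
Qed.

Lemma dim_join v w : v != 0 -> w != 0 -> pt v != pt w -> \dim (<[v]> + <[w]>)%VS = 2%N.
Proof.
move=> v0 w0 vw; rewrite dimv_disjoint_sum ?dim_vline ?v0 ?w0 //.
apply/eqP; rewrite -subv0; apply/subvP=> u; rewrite memv_cap memv0.
move=> /andP[/vlineP[a ->] /vlineP[b E]]; have [->|a0] := eqVneq a 0; first by rewrite scale0r.
case/negP: vw; apply/eqP/eq_pt=> //; exists (a^-1 * b).
  apply: contraNneq v0 => ab0; have : a *: v = 0.
    rewrite E; move/eqP: ab0; rewrite mulf_eq0 invr_eq0 (negbTE a0) => /eqP->.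
    by rewrite scale0r.
  by move/eqP; rewrite scaler_eq0 (negbTE a0).
by rewrite -scalerA -E scalerA mulVf // scale1r.
Qed.

Lemma line_joinE L v w : L \in lines F -> v != 0 -> w != 0 -> pt v != pt w ->
  pt v \in L -> pt w \in L -> L = line_of (<[v]> + <[w]>).
Proof.
case/linesP=> U dU -> v0 w0 vw; rewrite !mem_line_of // => vU wU; congr line_of.
apply/esym/eqP; rewrite eqEdim dim_join // dU leqnn andbT.
by rewrite subv_add -!memvE vU wU.
Qed.

Lemma line_join v w : v != 0 -> w != 0 -> pt v != pt w ->
  [/\ line_of (<[v]> + <[w]>) \in lines F,
      pt v \in line_of (<[v]> + <[w]>) & pt w \in line_of (<[v]> + <[w]>)].
Proof.
move=> v0 w0 vw; split; first by apply/linesP; exists (<[v]> + <[w]>)%VS; rewrite ?dim_join.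
  by rewrite mem_line_of // (subvP (addvSl _ _)) // memv_line.
by rewrite mem_line_of // (subvP (addvSr _ _)) // memv_line.
Qed.

Lemma mem_line_lin L v w a b : L \in lines F -> v != 0 -> w != 0 ->
  pt v \in L -> pt w \in L -> a *: v + b *: w != 0 -> pt (a *: v + b *: w) \in L.
Proof.
case/linesP=> U dU -> v0 w0 vU wU vw0; move: vU wU.
by rewrite !mem_line_of // => vU wU; rewrite memvD ?memvZ.
Qed.

Lemma mem_line_dec L v w u : L \in lines F -> v != 0 -> w != 0 -> u != 0 -> pt v != pt w ->
  pt v \in L -> pt w \in L -> pt u \in L -> exists a b, u = a *: v + b *: w.
Proof.
move=> LL v0 w0 u0 vw vL wL; rewrite (line_joinE LL v0 w0) // mem_line_of //.
by case/memv_addP=> _ /vlineP[a ->] [_ /vlineP[b ->] ->]; exists a, b.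
Qed.

Lemma eq_line P R L M : L \in lines F -> M \in lines F -> P != R ->
  P \in L -> R \in L -> P \in M -> R \in M -> L = M.
Proof.
case: (ptP P) => v v0 ->; case: (ptP R) => w w0 -> LL MM vw vL wL vM wM.
by rewrite (line_joinE LL v0 w0 vw vL wL) (line_joinE MM v0 w0 vw vM wM).
Qed.

Lemma exists_line P R : P != R -> exists L, [/\ L \in lines F, P \in L & R \in L].
Proof.
case: (ptP P) => v v0 ->; case: (ptP R) => w w0 -> vw.
by exists (line_of (<[v]> + <[w]>)); apply: line_join.
Qed.

(** Two distinct planes of a three-dimensional space meet in a line, by the dimension formula. *)
Lemma lines_meet L M : L \in lines F -> M \in lines F -> L != M ->
  exists P, L :&: M = [set P].
Proof.
move=> LL MM LM; have [U dU LE] := linesP _ LL; have [W dW ME] := linesP _ MM.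
have cap_gt0 : (0 < \dim (U :&: W))%N.
  have := dimv_sum_cap U W; rewrite dU dW => E.
  have : (\dim (U + W) <= 3)%N by apply: leq_trans (dimvS (subvf _)) _; rewrite dimvf.
  by move: E; set a := \dim (U + W); set b := \dim _; lia.
have u0 : vpick (U :&: W) != 0 by rewrite vpick0 -dimv_eq0 -lt0n.
have := memv_pick (U :&: W); rewrite memv_cap => /andP[uU uW].
exists (pt (vpick (U :&: W))); apply/setP=> R; rewrite !inE; apply/andP/eqP => [[RL RM]|->].
  apply/eqP; apply: contraNT LM => RP; apply/eqP; apply: (eq_line LL MM RP) => //.
    by rewrite LE mem_line_of.
  by rewrite ME mem_line_of.
by rewrite LE ME !mem_line_of.
Qed.

Lemma mem_linf v : v != 0 -> (pt v \in linf F) = (v 0 ord_max == 0).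
Proof.
move=> v0; rewrite inE val_pt //; apply/forallP/eqP => [/(_ v)|v2 w].
  by rewrite memv_line => /eqP.
by apply/implyP=> /vlineP[a ->]; rewrite mxE v2 mulr0.
Qed.

Lemma linf_line : linf F \in lines F.
Proof.
have [e0 e1] : vec 1 0 0 != 0 /\ vec 0 1 0 != 0 by rewrite !vec_eq0 oner_eq0 !andbF.
have ee : pt (vec 1 0 0) != pt (vec 0 1 0).
  apply/eqP=> /eq_pt-/(_ e0 e1)[a _]; rewrite vec_scale => /vec_inj[/eqP].
  by rewrite mulr0 oner_eq0.
suff -> : linf F = line_of (<[vec 1 0 0]> + <[vec 0 1 0]>) by case: (line_join e0 e1 ee).
apply/setP=> P; have [v v0 ->] := ptP P; rewrite mem_linf // mem_line_of //.
apply/eqP/memv_addP => [v2|[_ /vlineP[a ->] [_ /vlineP[b ->] ->]]].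
  exists (v 0 0 *: vec 1 0 0); first by rewrite memvZ // memv_line.
  exists (v 0 1 *: vec 0 1 0); first by rewrite memvZ // memv_line.
  by rewrite vec_lin [LHS]vecE v2 !mulr0 !mulr1 addr0 add0r addr0.
by rewrite vec_lin vec_coord !mulr0 addr0.
Qed.

Section Frame.
Variable M : 'M[F]_3.
Hypothesis uM : M \in unitmx.

Lemma frame_eq0 u : (u *m M == 0) = (u == 0).
Proof.
apply/eqP/eqP => [E|->]; last by rewrite mul0mx.
by rewrite -(mulmxK uM u) E mul0mx.
Qed.

Lemma frame_inj u v : u *m M = v *m M -> u = v.
Proof. by move=> E; rewrite -(mulmxK uM u) E mulmxK. Qed.

Lemma frameP P : exists2 u, u != 0 & P = pt (u *m M).
Proof.
have [v v0 ->] := ptP P; exists (v *m invmx M); last by rewrite mulmxKV.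
by apply: contraNneq v0 => E; rewrite -(mulmxKV uM v) E mul0mx.
Qed.

Lemma eq_fpt u v : u != 0 -> v != 0 ->
  pt (u *m M) = pt (v *m M) <-> exists2 a, a != 0 & u = a *: v.
Proof.
move=> u0 v0; rewrite eq_pt ?frame_eq0 //; split=> -[a a0 E]; exists a => //.
  by apply: frame_inj; rewrite E scalemxAl.
by rewrite E scalemxAl.
Qed.

(** The vertices of a frame span the whole space. *)
Lemma frame_not_line L : L \in lines F ->
  pt (vec 1 0 0 *m M) \in L -> pt (vec 0 1 0 *m M) \in L ->
  pt (vec 0 0 1 *m M) \in L -> False.
Proof.
case/linesP=> U dU ->; rewrite !mem_line_of ?frame_eq0 ?vec_eq0 ?oner_eq0 ?andbF // => e0 e1 e2.
suff : (fullv <= U)%VS by move/dimvS; rewrite dU dimvf.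
apply/subvP=> v _; rewrite -(mulmxKV uM v); set u := v *m _.
have -> : u = u 0 0 *: vec 1 0 0 + (u 0 1 *: vec 0 1 0 + u 0 ord_max *: vec 0 0 1).
  by rewrite [LHS]vecE !vec_scale !vecD; congr vec; ring.
by rewrite !mulmxDl -!scalemxAl !memvD // memvZ.
Qed.
End Frame.
End Points.

(** * Baer subplanes *)

Section Baer.
Variables (q : nat) (F : finFieldType).
Hypothesis (ppq : prime_power q) (cardF : #|F| = (q ^ 2)%N).
Local Notation V := 'rV[F]_3.
Local Notation GFq := (@GFq F q).
Implicit Types (u v w : V) (P R : point F) (L : {set point F}).

Definition frob v : V := map_mx (fun x => x ^+ q) v.

Lemma frob_lin a b u v : frob (a *: u + b *: v) = a ^+ q *: frob u + b ^+ q *: frob v.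
Proof. by apply/rowP=> i; rewrite !mxE (frobeniusD ppq cardF) !exprMn. Qed.

Lemma frob_id v : reflect (frob v = v) (v \is a mxOver GFq).
Proof.
apply: (iffP mxOverP) => [vG|E i j].
  by apply/rowP=> i; rewrite mxE; apply/eqP; apply: vG.
by have /rowP/(_ j) := E; rewrite GFqE (ord1 i) mxE => ->.
Qed.

Lemma frob_eq0 v : (frob v == 0) = (v == 0).
Proof.
have q0 := ltnW (q_gt1 cardF).
apply/eqP/eqP => /rowP E; apply/rowP=> i; have /eqP := E i; rewrite !mxE.
  by rewrite expf_eq0 q0 => /eqP.
by move=> /eqP ->; rewrite expr0n gtn_eqF.
Qed.

(** The multiple of [u] with a coordinate equal to [1] is fixed by Frobenius, since its image is
    proportional to it and has the same coordinate. *)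
Lemma frob_fixed_multiple u a : u != 0 -> frob u = a *: u ->
  exists2 b, b != 0 & b *: u \is a mxOver GFq.
Proof.
move=> u0 E; have [i ui] : exists i, u 0 i != 0.
  by apply/existsP; apply: contraR u0 => /existsPn u0; apply/eqP/rowP=> i;
     rewrite mxE; apply/eqP; rewrite -[_ == _]negbK u0.
exists (u 0 i)^-1; first by rewrite invr_neq0.
apply/frob_id/rowP=> j; rewrite !mxE exprMn exprVn.
have /rowP Ei := E; have := Ei i; have := Ei j; rewrite !mxE => -> ->.
have a0 : a != 0.
  apply: contraNneq ui => a0; have := Ei i; rewrite !mxE a0 mul0r => /eqP.
  by rewrite expf_eq0 => /andP[].
by rewrite invfM mulrACA mulVf // mul1r.
Qed.

(** The image of PG(2, q) under the projectivity with matrix [M]. *)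
Definition baer (M : 'M[F]_3) : {set point F} :=
  [set P : point F | [exists v : V,
     [&& v != 0, v \is a mxOver GFq & val P == <[v *m M]>%VS]]].

Section Frame.
Variable M : 'M[F]_3.
Hypothesis uM : M \in unitmx.

Lemma baerP P : reflect (exists v, [/\ v != 0, v \is a mxOver GFq & P = pt (v *m M)])
                        (P \in baer M).
Proof.
rewrite inE; apply: (iffP existsP) => [[v /and3P[v0 vG /eqP vP]]|[v [v0 vG ->]]].
  by exists v; split=> //; apply: pt_val.
by exists v; rewrite v0 vG val_pt ?frame_eq0 // eqxx.
Qed.

Lemma mxOver_lin a b v w : a \in GFq -> b \in GFq -> v \is a mxOver GFq ->
  w \is a mxOver GFq -> a *: v + b *: w \is a mxOver GFq.
Proof.
rewrite !GFqE => /eqP aG /eqP bG /frob_id vG /frob_id wG.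
by apply/frob_id; rewrite frob_lin aG bG vG wG.
Qed.

Lemma indep v w a b : v != 0 -> w != 0 -> pt (v *m M) != pt (w *m M) ->
  a *: v + b *: w = 0 -> a = 0 /\ b = 0.
Proof.
move=> v0 w0 vw E; have [a0|a0] := eqVneq a 0.
  move/eqP: E; rewrite a0 scale0r add0r scaler_eq0 (negbTE w0) orbF => /eqP->.
  by [].
case/negP: vw; apply/eqP/(eq_fpt uM) => //; exists (- (a^-1 * b)); last first.
  apply: (scalerI a0); apply/eqP; rewrite -subr_eq0 scalerA mulrN mulVKf //.
  by rewrite scaleNr opprK E.
apply: contraNneq v0 => /eqP; rewrite oppr_eq0 mulf_eq0 invr_eq0 (negbTE a0) => /eqP b0.
by move/eqP: E; rewrite b0 scale0r addr0 scaler_eq0 (negbTE a0).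
Qed.

Lemma indep2 v w a b a' b' : v != 0 -> w != 0 -> pt (v *m M) != pt (w *m M) ->
  a *: v + b *: w = a' *: v + b' *: w -> a = a' /\ b = b'.
Proof.
move=> v0 w0 vw E; have [|/subr0_eq-> /subr0_eq->//] := indep (a := a - a') (b := b - b') v0 w0 vw.
by rewrite !scalerBl addrACA E -opprD subrr.
Qed.

Lemma line_frame_dec L v w u : L \in lines F -> v != 0 -> w != 0 -> u != 0 ->
  pt (v *m M) != pt (w *m M) ->
  pt (v *m M) \in L -> pt (w *m M) \in L -> pt (u *m M) \in L ->
  exists a b, u = a *: v + b *: w.
Proof.
move=> LL v0 w0 u0 vw vL wL uL.
have [|||a [b E]] := mem_line_dec LL _ _ _ vw vL wL uL; rewrite ?frame_eq0 //.
by exists a, b; apply: (frame_inj uM); rewrite E !scalemxAl -mulmxDl.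
Qed.

Lemma line_frame_lin L v w a b : L \in lines F -> v != 0 -> w != 0 ->
  pt (v *m M) \in L -> pt (w *m M) \in L -> a *: v + b *: w != 0 ->
  pt ((a *: v + b *: w) *m M) \in L.
Proof.
move=> LL v0 w0 vL wL vw; rewrite mulmxDl -!scalemxAl.
apply: mem_line_lin; rewrite ?frame_eq0 //.
by rewrite !scalemxAl -mulmxDl frame_eq0.
Qed.

(** [u] is a combination of two Frobenius-fixed vectors, hence so is its image. *)
Lemma frob_line L v w u : L \in lines F -> v != 0 -> w != 0 -> u != 0 ->
  v \is a mxOver GFq -> w \is a mxOver GFq -> pt (v *m M) != pt (w *m M) ->
  pt (v *m M) \in L -> pt (w *m M) \in L -> pt (u *m M) \in L ->
  pt (frob u *m M) \in L.
Proof.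
move=> LL v0 w0 u0 /frob_id vG /frob_id wG vw vL wL uL.
have [a [b E]] := line_frame_dec LL v0 w0 u0 vw vL wL uL.
have := frob_eq0 u; rewrite (negbTE u0) => /negbT.
by rewrite E frob_lin vG wG; apply: line_frame_lin.
Qed.

(** The coefficients of a fixed vector in a basis of fixed vectors are fixed, by uniqueness. So
    the trace consists of one of the two given points and of [v + b *: w] with [b] in GF(q). *)
Lemma baer_trace_card L : L \in lines F -> (1 < #|L :&: baer M|)%N ->
  #|L :&: baer M| = q.+1.
Proof.
move=> LL /card_gt1P[P [R]] []; rewrite !in_setI => /andP[PL /baerP[v [v0 vG PE]]].
move=> /andP[RL /baerP[w [w0 wG RE]]] PR; subst P R.
have vbw0 b : v + b *: w != 0.
  apply/eqP=> E; have [|/eqP] := @indep v w 1 b v0 w0 PR; last by rewrite oner_eq0.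
  by rewrite scale1r.
have -> : L :&: baer M = pt (w *m M) |: [set pt ((v + b *: w) *m M) | b in [set b in GFq]].
  apply/setP=> P; rewrite in_setI in_setU1; apply/andP/orP.
    case=> PL' /baerP[u [u0 uG PE]]; subst P.
    have [a [b uE]] := line_frame_dec LL v0 w0 u0 PR PL RL PL'.
    have /frob_id := uG; rewrite uE frob_lin.
    have /frob_id-> := vG; have /frob_id-> := wG.
    case/(indep2 v0 w0 PR) => aG bG; have [a0|a0] := eqVneq a 0.
      left; apply/eqP/(eq_fpt uM) => //; rewrite -?uE //; exists b.
        by apply: contraNneq u0 => b0; rewrite uE a0 b0 !scale0r addr0.
      by rewrite uE a0 scale0r add0r.
    right; apply/imsetP; exists (b / a).
      by rewrite inE inE expr_div_n aG bG.
    apply/(eq_fpt uM); rewrite -?uE //; exists a => //.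
    by rewrite uE scalerDr scalerA mulrCA mulfV // mulr1.
  case=> [/eqP->|/imsetP[b bG ->]]; first by split=> //; apply/baerP; exists w.
  split; first by rewrite -[v]scale1r; apply: line_frame_lin; rewrite ?scale1r.
  apply/baerP; exists (v + b *: w); split=> //.
  by rewrite in_set in bG; rewrite -[v]scale1r; apply: mxOver_lin => //; apply: GFq1.
rewrite cardsU1 card_in_imset ?(card_GFq cardF).
  suff -> : pt (w *m M) \notin [set pt ((v + b *: w) *m M) | b in [set b in GFq]] by [].
  apply/imsetP=> -[b _ /(eq_fpt uM)-/(_ w0 (vbw0 b))[a a0 E]].
  have [|/eqP] := @indep v w a (a * b - 1) v0 w0 PR; last by rewrite (negbTE a0).
  by rewrite scalerBl addrA -scalerA -scalerDr -E scale1r subrr.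
move=> b b' _ _ /(eq_fpt uM)-/(_ (vbw0 b) (vbw0 b'))[a a0].
rewrite scalerDr scalerA -[X in X + _]scale1r => /(indep2 v0 w0 PR)[<-].
by rewrite mul1r.
Qed.

(** The common point of two Frobenius-invariant lines is Frobenius-invariant, so it is spanned
    by a vector over GF(q). This avoids solving linear systems over the subfield. *)
Lemma baer_lines_meet L L' : L \in lines F -> L' \in lines F -> L != L' ->
  (1 < #|L :&: baer M|)%N -> (1 < #|L' :&: baer M|)%N ->
  exists2 P, L :&: L' = [set P] & P \in baer M.
Proof.
move=> LL LL' LnL' /card_gt1P[P1 [R1]] []; rewrite !in_setI.
move=> /andP[PL1 /baerP[v1 [v10 vG1 PE1]]] /andP[RL1 /baerP[w1 [w10 wG1 RE1]]] PR1; subst P1 R1.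
move=> /card_gt1P[P1 [R1]] []; rewrite !in_setI.
move=> /andP[PL2 /baerP[v2 [v20 vG2 PE2]]] /andP[RL2 /baerP[w2 [w20 wG2 RE2]]] PR2; subst P1 R1.
have [P LLP] := lines_meet LL LL' LnL'; exists P => //.
have : P \in L :&: L' by rewrite LLP set11.
have [u u0 PE] := frameP uM P; rewrite PE in_setI => /andP[uL uL'].
(* The Frobenius map preserves both lines, hence fixes their common point. *)
have : pt (frob u *m M) \in L :&: L'.
  by rewrite in_setI (frob_line LL _ _ _ vG1 wG1 PR1) // (frob_line LL' _ _ _ vG2 wG2 PR2).
rewrite LLP in_set1 PE => /eqP/(eq_fpt uM)[]; rewrite ?frob_eq0 //.
move=> a _ /(frob_fixed_multiple u0)[b b0 bG].
apply/baerP; exists (b *: u); split=> //; first by rewrite scaler_eq0 negb_or b0.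
by rewrite -scalemxAl ptZ.
Qed.

Lemma baer_subplane : subplane q (lines F) (baer M).
Proof.
have e0 := GFq0 cardF; have e1 := GFq1 q F.
apply/and5P; split.
- by apply/forall_inP=> _ /imsetP[L _ ->]; apply: subsetIr.
- apply/forall_inP=> P PB; apply/forall_inP=> R RB; apply/implyP=> PR.
  have [L [LL PL RL]] := exists_line PR.
  apply/cards1P; exists (L :&: baer M); apply/setP=> L'; rewrite in_set in_set1.
  apply/andP/eqP => [[/imsetP[L1]]|->].
    rewrite inE => /andP[LL1 _] ->; rewrite !in_setI => /andP[/andP[PL1 _] /andP[RL1 _]].
    by rewrite (eq_line LL1 LL PR).
  rewrite !in_setI PL PB RL RB; split=> //; apply/imsetP; exists L => //; rewrite inE LL /=.
  by apply/card_gt1P; exists P, R; rewrite !in_setI PL PB RL RB.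
- apply/forall_inP=> _ /imsetP[L /[!inE]/andP[LL cL] ->].
  apply/forall_inP=> _ /imsetP[L' /[!inE]/andP[LL' cL'] ->]; apply/implyP=> LnL'.
  have {}LnL' : L != L' by apply: contraNneq LnL' => ->.
  have [P LLP PB] := baer_lines_meet LL LL' LnL' cL cL'.
  by rewrite -setIIl LLP (setIidPl _) ?sub1set // cards1.
- pose e i := match i with 0%N => vec 1 0 0 | 1%N => vec 0 1 0 | 2%N => vec 0 0 1
               | _ => vec 1 1 1 end : V.
  have en0 i : e i != 0.
    by case: i => [|[|[|i]]]; rewrite vec_eq0 oner_eq0 ?andbF.
  have eG i : e i \is a mxOver GFq.
    by case: i => [|[|[|i]]]; apply/mxOverP=> k j; rewrite mxE; case: j => [[|[|[|]]]].
  pose p (i : 'I_4) := pt (e i *m M).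
  have p_inj : injective p.
    move=> i j /(eq_fpt uM)-/(_ (en0 _) (en0 _))[a a0 E]; apply/val_inj.
    case: i j E => [[|[|[|[|]]]] ? //] [[|[|[|[|]]]] ? //] /=; rewrite vec_scale;
    case/vec_inj=> /eqP + /eqP + /eqP; rewrite ?mulr1 ?mulr0 ?oner_eq0 //;
    by rewrite ?[0 == a]eq_sym ?(negbTE a0).
  apply/existsP; exists [set p i | i in 'I_4]; apply/and3P; split.
  + by apply/subsetP=> _ /imsetP[i _ ->]; apply/baerP; exists (e i).
  + by rewrite card_imset // card_ord.
  + apply/eqP/setP=> t; rewrite !inE; apply/negP=> /and3P[tA /eqP ct /existsP[L']].
    case/andP=> /imsetP[L /[!inE]/andP[LL _] ->] tL.
    (* A line through three of the four points contains the fourth, hence the whole plane. *)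
    have {L' tL} [i pL] : exists i, forall j, j != i -> p j \in L.
      have /eqP/cards1P[x Ax] : #|[set p i | i in 'I_4] :\: t| = 1%N.
        by rewrite cardsD (setIidPr tA) card_imset // card_ord ct.
      have : x \in [set p i | i in 'I_4] :\: t by rewrite Ax set11.
      rewrite in_setD => /andP[_ /imsetP[i _ xi]]; exists i => j ji.
      have : p j \in t.
        apply: contraNT ji => jt; apply/eqP/p_inj/eqP; rewrite -xi -in_set1 -Ax.
        by rewrite in_setD jt; apply: imset_f.
      by move/(subsetP tL); rewrite in_setI => /andP[].
    have [U dU LU] := linesP _ LL.
    have eU j (lt4 : (j < 4)%N) : j != i :> nat -> e j *m M \in U.
      move=> ji; have := pL (Ordinal lt4) ji.
      by rewrite LU mem_line_of ?frame_eq0.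
    have eE : e 3 = e 0%N + e 1%N + e 2 by rewrite /= !vecD !addr0 !add0r.
    have eME : e 3 *m M = e 0%N *m M + e 1%N *m M + e 2 *m M by rewrite eE !mulmxDl.
    suff e012 j : (j < 3)%N -> e j *m M \in U.
      by apply: (frame_not_line uM LL); rewrite LU mem_line_of ?frame_eq0 ?(en0 0%N) ?(en0 1%N)
        ?(en0 2) //; [apply: (e012 0%N)|apply: (e012 1%N)|apply: (e012 2)].
    move=> j3; have [ji|] := eqVneq j i; last exact/eU/ltnW.
    have := eU 3 isT; rewrite -ji eq_sym (ltn_eqF j3) eME => /(_ isT).
    rewrite -ji in eU; case: j {ji} j3 eU => [|[|[|//]]] _ eU.
    + by rewrite rpredDr ?rpredDr ?(eU 1%N) ?(eU 2).
    + by rewrite rpredDr ?rpredDl ?(eU 0%N) ?(eU 2).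
    + by rewrite rpredDl ?rpredD ?(eU 0%N) ?(eU 1%N).
- apply/forall_inP=> _ /imsetP[L /[!inE]/andP[LL cL] ->].
  by rewrite baer_trace_card.
Qed.
End Frame.
End Baer.

(** D has as many points as a line of the subplane, so it is the trace of the line at infinity;
    the trace of the line joining P and R meets it because the subplane is projective. *)
Lemma subplane_direction (F : finFieldType) (q : nat) (B D : {set point F}) (P R : point F) :
  subplane q (lines F) B -> D \subset B -> D \subset linf F -> #|D| = q.+1 -> (0 < q)%N ->
  P \in affine B -> R \in affine B -> P != R ->
  exists L Z, [/\ L \in lines F, P \in L, R \in L, Z \in L & Z \in D].
Proof.
case/and5P=> _ _ /forall_inP Bmeet _ /forall_inP Bcard DB Dl cD q0.
rewrite !in_setD => /andP[Pl PB] /andP[Rl RB] PR.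
have [L [LL PL RL]] := exists_line PR.
have traceL : L :&: B \in [set L :&: B | L in lines F & (1 < #|L :&: B|)%N].
  apply: imset_f; rewrite inE LL; apply/card_gt1P; exists P, R.
  by rewrite !in_setI PL PB RL RB.
have D_sub : D \subset linf F :&: B by rewrite subsetI Dl DB.
have tracel : linf F :&: B \in [set L :&: B | L in lines F & (1 < #|L :&: B|)%N].
  apply: imset_f; rewrite inE linf_line; apply: leq_trans (subset_leq_card D_sub).
  by rewrite cD ltnS.
have DE : D = linf F :&: B.
  by apply/eqP; rewrite eqEcard D_sub cD (eqP (Bcard _ tracel)) /= leqnn.
have : L :&: B != linf F :&: B.
  by apply: contraNneq Pl => /setP/(_ P); rewrite !in_setI PL PB !andbT => <-.
have /forall_inP/(_ _ tracel)/implyP meet := Bmeet _ traceL.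
move/meet/cards1P=> [Z ZE]; have : Z \in L :&: B :&: (linf F :&: B) by rewrite ZE set11.
by rewrite -DE !in_setI => /andP[/andP[ZL _] ZD]; exists L, Z.
Qed.

(** * Conics as quadratic forms *)

Section Conics.
Variable F : finFieldType.
Local Notation V := 'rV[F]_3.
Local Notation P3 := {mpoly F[3]}.
Implicit Types (u v w : V) (Q : P3) (M C : 'M[F]_3).

Definition Xrow : 'rV[P3]_3 := \row_i 'X_i.

Definition mxpolyC m n (A : 'M[F]_(m, n)) : 'M[P3]_(m, n) := map_mx (@mpolyC 3 F) A.

Definition quad_form C : P3 := (Xrow *m mxpolyC C *m Xrow^T) 0 0.

(** Every monomial of degree 2 is a product of two variables, so the matrix can be built
    monomial by monomial; it need not be symmetric. *)
Lemma homog2_quad_form Q : Q \is 2.-homog -> exists C, Q = quad_form C.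
Proof.
move=> /dhomogP Qh; rewrite [Q]mpolyE.
suff: forall s : seq 'X_{1..3}, {in s, forall m, mdeg m = 2%N} ->
    exists C, \sum_(m <- s) Q@_m *: 'X_[m] = quad_form C by apply; apply: Qh.
elim=> [_|m s IH ms].
  by exists 0; rewrite big_nil /quad_form /mxpolyC map_mx0 mulmx0 mul0mx mxE.
have [|C CE] := IH; first by move=> n ns; apply: ms; rewrite inE ns orbT.
have [i [j mE]] : exists i j, m = (U_(i) + U_(j))%MM.
  have md := ms m (mem_head _ _).
  have [i mi] : exists i, m i != 0%N.
    apply/existsP; apply: contraTT isT => /existsPn m0.
    have : mdeg m == 0%N by rewrite mdeg_eq0; apply/eqP/mnmP=> i;
      rewrite mnm0E; apply/eqP; rewrite -[_ == _]negbK m0.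
    by rewrite md.
  have le_im : (U_(i) <= m)%MM.
    by apply/mnm_lepP=> j; rewrite mnm1E; case: eqP => // <-; rewrite lt0n.
  have : mdeg (m - U_(i)) == 1%N.
    by rewrite -(eqn_add2r (mdeg U_(i))) -mdegD submK // md mdeg1.
  rewrite mdeg_eq1 => /existsP[j /eqP mj]; exists j, i.
  by rewrite -mj submK.
exists (Q@_m *: delta_mx i j + C); rewrite big_cons CE /quad_form /mxpolyC.
rewrite map_mxD mulmxDr mulmxDl [RHS]mxE; congr (_ + _).
rewrite mE mpolyXD map_mxZ map_delta_mx -scalemxAr -scalemxAl mxE.
rewrite -mul_mpolyC; congr (_ * _).
rewrite mxE (bigD1 j) //= big1 ?addr0; last first.
  move=> k kj; rewrite mxE big1 ?mul0r // => l _; rewrite !mxE (negbTE kj) andbF mulr0 //.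
rewrite !mxE (bigD1 i) //= big1 ?addr0; last first.
  by move=> k ki; rewrite !mxE (negbTE ki) mulr0.
by rewrite !mxE !eqxx mulr1.
Qed.

Definition eval_at v : P3 -> F := meval (fun i => v 0 i).
HB.instance Definition _ v := GRing.RMorphism.on (eval_at v).

Lemma eval_Xrow v : map_mx (eval_at v) Xrow = v.
Proof. by apply/rowP=> i; rewrite !mxE /eval_at mevalXU. Qed.

Lemma eval_mxpolyC v m n (A : 'M[F]_(m, n)) : map_mx (eval_at v) (mxpolyC A) = A.
Proof. by apply/matrixP=> i j; rewrite !mxE /eval_at mevalC. Qed.

Lemma eval_quad_form v C : eval_at v (quad_form C) = (v *m C *m v^T) 0 0.
Proof.
transitivity (map_mx (eval_at v) (Xrow *m mxpolyC C *m Xrow^T) 0 0); first by rewrite mxE.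
by rewrite !map_mxM -map_trmx eval_Xrow eval_mxpolyC.
Qed.

Definition qvalue C u : F := (u *m C *m u^T) 0 0.

Lemma mem_zeros_quad_form C v : v != 0 -> (pt v \in zeros (quad_form C)) = (qvalue C v == 0).
Proof.
move=> v0; rewrite inE val_pt //; apply/forallP/eqP => [/(_ v)|vC w].
  by rewrite memv_line /= -/(eval_at v (quad_form C)) eval_quad_form => /eqP.
apply/implyP=> /vlineP[a ->]; rewrite -/(eval_at (a *: v) (quad_form C)) eval_quad_form.
rewrite linearZ /= -!scalemxAr -!scalemxAl mxE mxE.
by rewrite -/(qvalue C v) vC !mulr0.
Qed.

Lemma sum3 (R : zmodType) (f : 'I_3 -> R) : \sum_i f i = f 0 + f 1 + f ord_max.
Proof.
rewrite !big_ord_recl big_ord0 addr0 addrA; congr (_ + f _ + f _); exact: val_inj.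
Qed.

(** The linear forms dual to the rows of [M]: they read off coordinates in that frame. *)
Definition coordf M i : P3 := (Xrow *m mxpolyC (invmx M)) 0 i.

Lemma coordf_at0 M i : eval_at 0 (coordf M i) = 0.
Proof.
transitivity (map_mx (eval_at 0) (Xrow *m mxpolyC (invmx M)) 0 i); first by rewrite mxE.
by rewrite map_mxM eval_Xrow mul0mx mxE.
Qed.

(** The change of variables takes place in the polynomial ring, so that a factorization of
    the form in the new coordinates contradicts irreducibility. *)
Lemma quad_form_frame M C : M \in unitmx ->
  quad_form C = \sum_i \sum_j (M *m C *m M^T) i j *: (coordf M i * coordf M j).
Proof.
move=> uM; pose L := Xrow *m mxpolyC (invmx M).
have XE : Xrow = L *m mxpolyC M.
  by rewrite /L -mulmxA -map_mxM mulVmx // map_mx1 mulmx1.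
have -> : quad_form C = (L *m mxpolyC (M *m C *m M^T) *m L^T) 0 0.
  by rewrite /quad_form XE trmx_mul /mxpolyC !map_mxM map_trmx !mulmxA.
rewrite exchange_big mxE; apply: eq_bigr => j _; rewrite mxE mulr_suml.
apply: eq_bigr => i _; rewrite -mul_mpolyC [L^T j 0]mxE [mxpolyC _ i j]mxE.
by rewrite -mulrA mulrCA mulrA.
Qed.

(** A unit would keep a unit value at every vector, so a polynomial that vanishes at [0] is not
    a unit. *)
Lemma irreducible_no_linear_factors (Q A B : P3) : irreducible_mpoly Q ->
  eval_at 0 A = 0 -> eval_at 0 B = 0 -> Q <> A * B.
Proof.
move=> [_ irr] A0 B0 /irr /orP[] /(rmorph_unit (eval_at 0)); by rewrite /= ?A0 ?B0 unitr0.
Qed.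

Lemma qvalue_frame M C u : qvalue C (u *m M) = qvalue (M *m C *m M^T) u.
Proof. by rewrite /qvalue trmx_mul !mulmxA. Qed.

Lemma qvalue_vec C x y z : qvalue C (vec x y z) =
  C 0 0 * x ^+ 2 + C 1 1 * y ^+ 2 + (C 0 1 + C 1 0) * (x * y)
  + (C 0 ord_max + C ord_max 0) * (x * z) + (C 1 ord_max + C ord_max 1) * (y * z)
  + C ord_max ord_max * z ^+ 2.
Proof. by rewrite /qvalue mxE sum3 !mxE !sum3 !mxE /=; ring. Qed.

(** The first two vertices lie on the conic, so the squares of the first two coordinates do not
    occur; the two inequalities hold because the form would otherwise factor. *)
Lemma conic_frame (K : {set point F}) M : conic K -> M \in unitmx ->
  pt (vec 1 0 0 *m M) \in K -> pt (vec 0 1 0 *m M) \in K ->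
  exists c d e f, [/\ c != 0, d * e - c * f != 0 &
    forall x y z, vec x y z != 0 -> (pt (vec x y z *m M) \in K) =
      (c * (x * y) + d * (x * z) + e * (y * z) + f * z ^+ 2 == 0)].
Proof.
case=> Q [Qh Qirr KE] uM; have [C QE] := homog2_quad_form Qh.
pose C' := M *m C *m M^T.
have memK x y z : vec x y z != 0 ->
    (pt (vec x y z *m M) \in K) = (qvalue C' (vec x y z) == 0).
  by move=> v0; rewrite KE QE mem_zeros_quad_form ?frame_eq0 // qvalue_frame.
rewrite !memK ?vec_eq0 ?oner_eq0 ?andbF // !qvalue_vec => /eqP + /eqP.
rewrite !(expr0n, expr1n, mulr0, mul0r, mulr1, addr0, add0r) /= => C00 C11.
set c := C' 0 1 + C' 1 0; set d := C' 0 ord_max + C' ord_max 0.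
set e := C' 1 ord_max + C' ord_max 1; set f := C' ord_max ord_max.
exists c, d, e, f.
have {}QE : Q = c *: (coordf M 0 * coordf M 1) + d *: (coordf M 0 * coordf M ord_max)
    + e *: (coordf M 1 * coordf M ord_max) + f *: (coordf M ord_max * coordf M ord_max).
  rewrite QE (quad_form_frame _ uM) -/C' sum3 !sum3 C00 C11 !scale0r add0r addr0.
  by rewrite /c /d /e /f -!mul_mpolyC !mpolyCD; ring.
have evl a b g : eval_at 0 (a *: coordf M 0 + b *: coordf M 1 + g *: coordf M ord_max) = 0.
  by rewrite -!mul_mpolyC !rmorphD !rmorphM /= !coordf_at0 !mulr0 !addr0.
(* For [c = 0] the last coordinate divides the form; for [d e = c f] it is the product of
   [c X + e Z] and [Y + (d / c) Z]. *)
have c0 : c != 0.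
  apply/eqP=> c0; apply: (irreducible_no_linear_factors Qirr (coordf_at0 M ord_max) (evl d e f)).
  by rewrite QE c0 -!mul_mpolyC; ring.
split=> //; last first.
  move=> x y z v0; rewrite memK // qvalue_vec C00 C11 !mul0r !add0r.
  by [].
apply/eqP=> defc; apply: (irreducible_no_linear_factors Qirr (evl c 0 e) (evl 0 1 (d / c))).
have fE : f = d * e / c by rewrite (subr0_eq defc) mulrAC divff // mul1r.
have cc : (c%:MP * (d / c)%:MP = d%:MP :> P3) by rewrite -mpolyCM mulrC divfK.
have ff : (f%:MP = (d / c)%:MP * e%:MP :> P3) by rewrite -mpolyCM fE mulrAC.
rewrite QE -!mul_mpolyC ff -cc mpolyC0 mpolyC1; ring.
Qed.
End Conics.

(** * A frame adapted to the hyperbola and the derivation set *)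

Section Mat3.
Variable F : finFieldType.
Local Notation V := 'rV[F]_3.
Implicit Types (u v w : V).

Definition mat3 u v w : 'M[F]_3 := \matrix_(i < 3) [:: u; v; w]`_i.

Lemma mat3_mul x y z u v w : vec x y z *m mat3 u v w = x *: u + y *: v + z *: w.
Proof. by apply/rowP=> j; rewrite mxE sum3 !mxE. Qed.

Lemma mat3_unit u v w :
  (forall x y z, x *: u + y *: v + z *: w = 0 -> [/\ x = 0, y = 0 & z = 0]) ->
  mat3 u v w \in unitmx.
Proof.
move=> free; rewrite -row_free_unit; apply: inj_row_free => t.
rewrite [t]vecE mat3_mul => /free[-> -> ->].
by apply/eqP; rewrite vec_eq0 !eqxx.
Qed.

Lemma lin3_coord x y z u v w j :
  (x *: u + y *: v + z *: w) 0 j = x * u 0 j + y * v 0 j + z * w 0 j.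
Proof. by rewrite !mxE. Qed.

Definition linf_vec (v : 'rV[F]_2) : V := row_mx v (0 : 'rV_1).

Lemma linf_vec_last (v : 'rV[F]_2) : linf_vec v 0 ord_max = 0.
Proof.
have -> : ord_max = rshift 2 (0 : 'I_1) :> 'I_3 by apply: val_inj.
by rewrite /linf_vec (row_mxEr v (0 : 'rV_1)) mxE.
Qed.

Lemma linf_vec_lin a b (v w : 'rV[F]_2) :
  a *: linf_vec v + b *: linf_vec w = linf_vec (a *: v + b *: w).
Proof.
have E : a *: row_mx v 0 + b *: row_mx w 0 = row_mx (a *: v + b *: w) 0 :> 'M[F]_(1, 2 + 1).
  by rewrite !scale_row_mx add_row_mx !scaler0 addr0.
exact: E.
Qed.

Lemma linf_vec_eq0 (v : 'rV[F]_2) : (linf_vec v == 0) = (v == 0).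
Proof.
have E : (row_mx v 0 == 0 :> 'M[F]_(1, 2 + 1)) = (v == 0) by rewrite row_mx_eq0 eqxx andbT.
exact: E.
Qed.

Lemma linf_vecP u : u 0 ord_max = 0 -> exists t : 'rV[F]_2, u = linf_vec t.
Proof.
move=> u2; pose u' : 'M[F]_(1, 2 + 1) := u.
have r0 : rsubmx u' = 0.
  apply/rowP=> i; rewrite mxE [RHS]mxE -u2; congr (u _ _); apply: val_inj => /=.
  by rewrite (ord1 i).
by exists (lsubmx u'); rewrite /linf_vec -r0 hsubmxK.
Qed.
End Mat3.

Section Frame.
Variables (q : nat) (F : finFieldType).
Hypothesis (ppq : prime_power q) (cardF : #|F| = (q ^ 2)%N).
Local Notation GFq := (@GFq F q).

(** Exchange with a standard basis vector, so that vectors over GF(q) have coordinates in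
    GF(q). *)
Lemma basis_complete (v0 : 'rV[F]_2) : v0 != 0 -> v0 \is a mxOver GFq ->
  exists v1 : 'rV[F]_2, [/\ v1 \is a mxOver GFq,
    forall v, exists a b, v = a *: v0 + b *: v1 /\
      (v \is a mxOver GFq -> a \in GFq /\ b \in GFq) &
    forall a b, a *: v0 + b *: v1 = 0 -> a = 0 /\ b = 0].
Proof.
move=> v00 /mxOverP v0G.
have [i vi] : exists i, v0 0 i != 0.
  apply/existsP; apply: contraNT v00 => /existsPn v0E; apply/eqP/rowP=> i.
  by rewrite mxE; apply/eqP; rewrite -[_ == _]negbK v0E.
have [j ji alln] : exists2 j : 'I_2, j != i & forall l, l = i \/ l = j.
  exists (rev_ord i); first by case: i {vi} => [[|[|]]].
  move=> l; case: (l =P i) => [->|li]; [by left|right]; apply: val_inj; move: li.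
  by case: i {vi} => [[|[|]]] //= ?; case: l => [[|[|]]] //= ? li; case: li; apply: val_inj.
exists (delta_mx 0 j); split.
- by apply/mxOverP=> k l; rewrite mxE; case: eqP => _; case: eqP => _;
     rewrite ?(GFq1 q F) ?(GFq0 cardF).
- move=> v; exists (v 0 i / v0 0 i), (v 0 j - v 0 i / v0 0 i * v0 0 j); split.
    apply/rowP=> l; rewrite !mxE eqxx /=; case: (alln l) => ->.
      by rewrite eq_sym (negbTE ji) mulr0 addr0 divfK.
    by rewrite eqxx mulr1 addrC subrK.
  move=> /mxOverP vG; have aG : v 0 i / v0 0 i \in GFq by rewrite GFqM // ?GFqV.
  by split=> //; rewrite (GFqB ppq cardF) // GFqM.
move=> a b /rowP E; have a0 : a = 0.
  have := E i; rewrite !mxE eqxx [i == j]eq_sym (negbTE ji) mulr0 addr0 => /eqP.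
  by rewrite mulf_eq0 (negbTE vi) orbF => /eqP.
by have := E j; rewrite !mxE !eqxx a0 mul0r add0r mulr1.
Qed.

(** The first two vertices are the infinite points of K, the third is its centre. The first
    vertex [p] completes to a GF(q)-basis [p, d] of the vectors that span D; scaling the second
    vertex [r] makes [d = r + c *: p], and [c] is outside GF(q) because [r] does not
    represent a point of D. *)
Lemma mixed_frame (D K : {set point F}) : mixed_hyperbola q D K ->
  exists (M : 'M[F]_3) (c k : F), [/\ M \in unitmx, c \notin GFq, k != 0,
    (forall x y z, vec x y z != 0 -> (pt (vec x y z *m M) \in linf F) = (z == 0)) &
  [/\ K :&: linf F = [set pt (vec 1 0 0 *m M); pt (vec 0 1 0 *m M)],
    (forall Z, Z \in D <-> exists a b, [/\ a \in GFq, b \in GFq,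
        (a != 0) || (b != 0) & Z = pt (vec (a + c * b) b 0 *m M)]) &
    (forall x y, (pt (vec x y 1 *m M) \in K) = (x * y == k))]].
Proof.
case=> _ _ [g ug ->] [Kc _] [P [R [Kl]]].
rewrite inE => /existsP[v0 /and3P[v00 v0G /eqP/pt_val PE]] RD.
have [v1 [v1G span free]] := basis_complete v00 v0G.
pose p := linf_vec (v0 *m g); pose d := linf_vec (v1 *m g).
have free_pd a b : a *: p + b *: d = 0 -> a = 0 /\ b = 0.
  move/eqP; rewrite linf_vec_lin linf_vec_eq0 !scalemxAl -mulmxDl => /eqP E; apply: free.
  by rewrite -(mulmxK ug (_ + _)) E mul0mx.
have span_pd (w : 'rV[F]_3) : w 0 ord_max = 0 -> exists a b, w = a *: p + b *: d.
  move=> /linf_vecP[v ->]; have [a [b [E _]]] := span (v *m invmx g); exists a, b.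
  by rewrite linf_vec_lin !scalemxAl -mulmxDl -E mulmxKV.
have memD Z : Z \in baer_subline q g <-> exists a b, [/\ a \in GFq, b \in GFq,
        (a != 0) || (b != 0) & Z = pt (a *: p + b *: d)].
  rewrite inE; split=> [/existsP[v /and3P[vn0 vG /eqP/pt_val->]]|[a [b [aG bG ab ->]]]].
    have [a [b [E /(_ vG)[aG bG]]]] := span v; exists a, b; split=> //.
      apply: contraR vn0; rewrite negb_or !negbK => /andP[/eqP a0 /eqP b0].
      by rewrite E a0 b0 !scale0r addr0.
    by rewrite linf_vec_lin !scalemxAl -mulmxDl -E.
  apply/existsP; exists (a *: v0 + b *: v1); apply/and3P; split.
  - by apply: contraL ab => /eqP/free[-> ->]; rewrite eqxx.
  - apply/mxOverP=> i j; rewrite !mxE; move/mxOverP: v0G => v0G; move/mxOverP: v1G => v1G.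
    by rewrite (GFqD ppq cardF) // GFqM.
  rewrite val_pt.
    by rewrite linf_vec_lin !scalemxAl -mulmxDl.
  by apply: contraL ab => /eqP/free_pd[-> ->]; rewrite eqxx.
have [w w0 RE] := ptP R.
have Rl : R \in linf F.
  by have : R \in K :&: linf F; [rewrite Kl !inE eqxx orbT | rewrite in_setI => /andP[]].
have [a [b wE]] : exists a b, w = a *: p + b *: d.
  by apply/span_pd/eqP; rewrite -(mem_linf w0) -RE.
have b0 : b != 0.
  apply: contraNneq RD => b0; apply/memD; exists 1, 0.
  rewrite (GFq1 q F) (GFq0 cardF) oner_eq0; split=> //.
  have a0 : a != 0 by apply: contraNneq w0 => a0; rewrite wE a0 b0 !scale0r addr0.
  by rewrite RE wE b0 !scale0r !addr0 scale1r ptZ.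
(* [r] is the multiple [b^-1 *: w] of [w], so that R is spanned by it and [d = r + c *: p]. *)
pose c := - (a / b); pose r := d - c *: p.
have Rr : R = pt r.
  rewrite RE -(@ptZ _ b^-1) ?invr_neq0 // wE scalerDr !scalerA mulVf // scale1r.
  by rewrite /r /c scaleNr opprK addrC mulrC.
have cG : c \notin GFq.
  apply: contra RD => cG; apply/memD; exists (- c), 1.
  rewrite (GFq1 q F) (GFqN ppq cardF) // oner_eq0 orbT; split=> //.
  by rewrite Rr /r -scaleNr scale1r addrC.
have Pp : P = pt p by rewrite PE.
pose M0 := mat3 p r (vec 0 0 1).
have last_pr x y z : (x *: p + y *: r + z *: vec 0 0 1) 0 ord_max = z.
  have r2 : r 0 ord_max = 0.
    have -> : r = - c *: p + 1 *: d + 0 *: d by rewrite scaleNr scale1r scale0r addr0 addrC.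
    by rewrite lin3_coord !linf_vec_last; ring.
  by rewrite lin3_coord r2 linf_vec_last vec_coord; ring.
have uM0 : M0 \in unitmx.
  apply: mat3_unit => x y z E; have z0 : z = 0 by rewrite -(last_pr x y z) E mxE.
  have [xy y0] : x - y * c = 0 /\ y = 0.
    apply: free_pd; rewrite -[RHS]E z0 /r scalerBr scale0r addr0 scalerBl scalerA.
    by rewrite addrAC addrA.
  by split=> //; move: xy; rewrite y0 mul0r subr0.
have [PK RK] : P \in K /\ R \in K.
  have : P \in K :&: linf F by rewrite Kl !inE eqxx.
  have : R \in K :&: linf F by rewrite Kl !inE eqxx orbT.
  by rewrite !in_setI => /andP[-> _] /andP[-> _].
have [||c' [d' [e' [f' [c0' k0' memK]]]]] := conic_frame Kc uM0.
- by rewrite mat3_mul !scale0r !addr0 scale1r -Pp.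
- by rewrite mat3_mul !scale0r addr0 add0r scale1r -Rr.
(* The third vertex moves to the centre of the hyperbola, which removes the linear terms. *)
pose M := mat3 p r (vec 0 0 1 - (e' / c') *: p - (d' / c') *: r).
have MM0 x y z : vec x y z *m M = vec (x - z * (e' / c')) (y - z * (d' / c')) z *m M0.
  rewrite !mat3_mul !scalerBr !scalerBl !scalerA.
  by apply/rowP=> i; rewrite !mxE; ring.
have uM : M \in unitmx.
  rewrite -row_free_unit; apply: inj_row_free => t; rewrite [t]vecE MM0.
  move/eqP; rewrite frame_eq0 // vec_eq0 => /and3P[+ + /eqP t2].
  by rewrite t2 !mul0r !subr0 => /eqP-> /eqP->; apply/eqP; rewrite vec_eq0 !eqxx.
exists M, c, ((d' * e' - c' * f') / c' ^+ 2); split=> //.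
- by rewrite mulf_neq0 ?invr_neq0 ?expf_neq0.
- by move=> x y z n0; rewrite mem_linf ?frame_eq0 // MM0 mat3_mul last_pr.
split.
- by rewrite Kl Pp Rr !MM0 !mul0r !subr0 !mat3_mul !scale0r !addr0 add0r !scale1r.
- move=> Z; rewrite memD; split=> -[x [y [xG yG xy ->]]]; exists x, y; split=> //; congr pt;
  rewrite MM0 !mul0r !subr0 mat3_mul scale0r addr0 /r scalerDl scalerBr scalerA;
  by apply/rowP=> i; rewrite !mxE; ring.
move=> x y; rewrite MM0 memK; last by rewrite vec_eq0 oner_eq0 !andbF.
rewrite !mul1r expr1n !mulr1.
have -> : c' * ((x - e' / c') * (y - d' / c')) + d' * (x - e' / c') + e' * (y - d' / c') + f'
   = c' * (x * y - (d' * e' - c' * f') / c' ^+ 2) by field.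
by rewrite mulf_eq0 (negbTE c0') subr_eq0.
Qed.
End Frame.

(** * Hall lines and chords of the hyperbola *)

Section MixedFrame.
Variables (q : nat) (F : finFieldType).
Hypotheses (ppq : prime_power q) (cardF : #|F| = (q ^ 2)%N) (oddq : odd q).
Local Notation GFq := (@GFq F q).
Variables (D K : {set point F}) (M : 'M[F]_3) (c k : F).
Hypotheses (uM : M \in unitmx) (cG : c \notin GFq) (k0 : k != 0).
Hypothesis mem_linfM : forall x y z, vec x y z != 0 ->
  (pt (vec x y z *m M) \in linf F) = (z == 0).
Hypothesis K_linf : K :&: linf F = [set pt (vec 1 0 0 *m M); pt (vec 0 1 0 *m M)].
Hypothesis memD : forall Z, Z \in D <-> exists a b, [/\ a \in GFq, b \in GFq,
  (a != 0) || (b != 0) & Z = pt (vec (a + c * b) b 0 *m M)].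
Hypothesis memK : forall x y, (pt (vec x y 1 *m M) \in K) = (x * y == k).
Implicit Types (x y z a b t m l : F).

Let vec1_neq0 x y : vec x y 1 != 0.
Proof. by rewrite vec_eq0 oner_eq0 !andbF. Qed.

Let vecm_neq0 m : vec m 1 0 != 0.
Proof. by rewrite vec_eq0 oner_eq0 !andbF. Qed.

Definition hpt x := pt (vec x (k / x) 1 *m M).

Definition infpt m := pt (vec m 1 0 *m M).

Lemma hpt_inj : injective hpt.
Proof.
move=> x y /(eq_fpt uM)-/(_ (vec1_neq0 _ _) (vec1_neq0 _ _))[a _].
by rewrite vec_scale => /vec_inj[-> _]; rewrite mulr1 => <-; rewrite mul1r.
Qed.

Lemma infpt_inj : injective infpt.
Proof.
move=> x y /(eq_fpt uM)-/(_ (vecm_neq0 _) (vecm_neq0 _))[a _].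
by rewrite vec_scale => /vec_inj[-> + _]; rewrite mulr1 => <-; rewrite mul1r.
Qed.

Lemma hpt_linf x : hpt x \notin linf F.
Proof. by rewrite mem_linfM ?oner_eq0. Qed.

Lemma infpt_linf m : infpt m \in linf F.
Proof. by rewrite mem_linfM ?eqxx. Qed.

Lemma affineK : affine K = hpt @: [set x | x != 0].
Proof.
apply/setP=> Z; rewrite in_setD; apply/andP/imsetP => [[]|[x x0 ->]]; last first.
  rewrite in_set in x0; rewrite hpt_linf memK mulrC divfK //.
have [u u0 ->] := frameP uM Z; rewrite [u]vecE in u0 *.
move: (u 0 0) (u 0 1) (u 0 ord_max) u0 => x y z u0; rewrite mem_linfM // => z0.
have -> : pt (vec x y z *m M) = pt (vec (z^-1 * x) (z^-1 * y) 1 *m M).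
  by apply/(eq_fpt uM); rewrite ?vec1_neq0 //; exists z; rewrite // vec_scale !mulVKf ?mulr1.
rewrite memK => /eqP xy; have x0 : z^-1 * x != 0.
  by apply: contraNneq k0 => E; rewrite -xy E mul0r.
by exists (z^-1 * x); rewrite ?inE // /hpt -xy mulrAC divff // mul1r.
Qed.

Lemma affineK_sub x : x != 0 -> hpt x \in affine K.
Proof. by move=> x0; rewrite affineK imset_f ?inE. Qed.

Lemma card_affineK : #|affine K| = (q ^ 2 - 1)%N.
Proof.
rewrite affineK card_imset; last exact: hpt_inj.
by rewrite -cardF subn1 -(cardC1 (0 : F)); apply: eq_card => x; rewrite !inE.
Qed.

Lemma chord_infpt L x y : L \in lines F -> x != 0 -> y != 0 -> x != y ->
  hpt x \in L -> hpt y \in L -> infpt (- (x * y) / k) \in L.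
Proof.
move=> LL x0 y0 xy xL yL.
have E : vec (- (x * y) / k) 1 0 =
   (x * y / (k * (y - x))) *: vec x (k / x) 1 + - (x * y / (k * (y - x))) *: vec y (k / y) 1.
  have yx : y - x != 0 by rewrite subr_eq0 eq_sym.
  by rewrite vec_lin; congr vec; field; rewrite ?k0 ?yx ?x0 ?y0.
by rewrite /infpt E; apply: line_frame_lin; rewrite -?E.
Qed.

Lemma line_linf_infpt L m Z : L \in lines F -> infpt m \in L -> (exists x, hpt x \in L) ->
  Z \in L -> Z \in linf F -> Z = infpt m.
Proof.
move=> LL mL [x xL] ZL Zl; apply/eqP; apply: contraNT (hpt_linf x) => Zm.
by rewrite -(eq_line LL (linf_line F) Zm) // infpt_linf.
Qed.

(** Two chords with a common endpoint on one line would have the same infinite point. *)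
Lemma no_three_collinear L x y z : L \in lines F -> x != 0 -> y != 0 -> z != 0 ->
  x != y -> x != z -> y != z -> hpt x \in L -> hpt y \in L -> hpt z \in L -> False.
Proof.
move=> LL x0 y0 z0 xy xz yz xL yL zL.
have Ixy := chord_infpt LL x0 y0 xy xL yL; have Ixz := chord_infpt LL x0 z0 xz xL zL.
have /infpt_inj/(divIf k0)/oppr_inj/(mulfI x0) :=
  line_linf_infpt LL Ixy (ex_intro _ x xL) Ixz (infpt_linf _).
by move/eqP; rewrite eq_sym (negbTE yz).
Qed.

(** The chord through the points with parameters [x] and [y] meets the line at infinity in
    [infpt (- (x * y) / k)], so it meets D exactly when [x * y] lies in this set. *)
Definition chord_products : {set F} := [set a | - a / k - c \in GFq].

Lemma infpt_D m : (infpt m \in D) = (m - c \in GFq).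
Proof.
apply/idP/idP => [/memD[a [b [aG bG ab]]]|mG]; last first.
  apply/memD; exists (m - c), 1; rewrite (GFq1 q F) oner_eq0 orbT; split=> //.
  by rewrite mulr1 subrK.
have n0 : vec (a + c * b) b 0 != 0.
  rewrite vec_eq0 eqxx andbT negb_and; have [b0|_] := eqVneq b 0; last by rewrite orbT.
  by rewrite b0 mulr0 addr0 orbF; move: ab; rewrite b0 eqxx orbF.
move=> /(eq_fpt uM)-/(_ (vecm_neq0 _) n0)[l l0]; rewrite vec_scale => /vec_inj[-> lb _].
have b0 : b != 0 by apply: contraTneq isT => b0; move/eqP: lb; rewrite b0 mulr0 oner_eq0.
have -> : l = b^-1 by rewrite -[LHS]mulr1 -[X in _ * X](divff b0) mulrA -lb mul1r.
have -> : b^-1 * (a + c * b) - c = a * b^-1 by field.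
by rewrite GFqM ?GFqV.
Qed.

Lemma chord_products0 : 0 \notin chord_products.
Proof.
rewrite in_set oppr0 mul0r add0r; apply: contra cG => /(GFqN ppq cardF).
by rewrite opprK.
Qed.

(** The frame of a subplane through D: its first two rows are [l] times a GF(q)-basis of D, and
    the third row represents the affine point [(a, b)]. *)
Definition baer_mx l a b : 'M[F]_3 :=
  mat3 (vec l 0 0) (vec (l * c) l 0) (vec a b 1) *m M.

Lemma baer_mxE l a b x y z :
  vec x y z *m baer_mx l a b = vec (l * (x + c * y) + z * a) (l * y + z * b) z *m M.
Proof.
rewrite mulmxA; congr (_ *m M); rewrite mat3_mul !vec_scale !vecD.
by congr vec; ring.
Qed.

Lemma baer_mx_unit l a b : l != 0 -> baer_mx l a b \in unitmx.
Proof.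
move=> l0; rewrite unitmx_mul uM andbT; apply: mat3_unit => x y z.
rewrite !vec_scale !vecD => /eqP; rewrite vec_eq0 !mulr0 !add0r mulr1 => /and3P[+ + /eqP z0].
rewrite z0 !mul0r !addr0 [y * l == 0]mulf_eq0 (negbTE l0) orbF => + /eqP y0.
by rewrite y0 mul0r addr0 mulf_eq0 (negbTE l0) orbF => /eqP.
Qed.

Lemma vec_GFq x y z : x \in GFq -> y \in GFq -> z \in GFq -> vec x y z \is a mxOver GFq.
Proof. by move=> *; apply/mxOverP=> i -[[|[|[|]]] //= j]; rewrite mxE. Qed.

(** Scaling by [l] and moving the third row do not affect the points at infinity. *)
Lemma D_trace l a b : l != 0 -> D = linf F :&: baer q (baer_mx l a b).
Proof.
move=> l0; have uN := baer_mx_unit a b l0; apply/setP=> Z; rewrite in_setI.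
apply/idP/andP => [/memD[x [y [xG yG xy ->]]]|].
  have n0 : vec x y 0 != 0 by rewrite vec_eq0 eqxx andbT negb_and.
  have E : pt (vec (x + c * y) y 0 *m M) = pt (vec x y 0 *m baer_mx l a b).
    rewrite baer_mxE !mul0r !addr0 -[in RHS](mulr0 l) -vec_scale -scalemxAl ptZ //.
  split.
    rewrite mem_linfM //; move: n0; rewrite !vec_eq0; apply: contra => /and3P[/[swap]/eqP-> + _].
    by rewrite mulr0 addr0 !eqxx !andbT.
  by rewrite E; apply/(baerP q uN); exists (vec x y 0); rewrite vec_GFq ?(GFq0 cardF).
case=> Zl /(baerP q uN)[u [u0 uG ZE]]; move: Zl; rewrite {Z}ZE.
rewrite [u]vecE in u0 uG *; move: (u 0 0) (u 0 1) (u 0 ord_max) u0 uG => x y z u0 uG.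
have Ne : vec (l * (x + c * y) + z * a) (l * y + z * b) z != 0.
  by rewrite -(frame_eq0 uM) -baer_mxE frame_eq0.
rewrite baer_mxE mem_linfM // => /eqP z0; subst z.
apply/memD; exists x, y; move/mxOverP: uG => uG.
have := uG 0 0; have := uG 0 1; rewrite !vec_coord => xG yG; split=> //.
  by move: u0; rewrite vec_eq0 eqxx andbT negb_and.
by rewrite !mul0r !addr0 -[in LHS](mulr0 l) -vec_scale -scalemxAl ptZ.
Qed.

Lemma D_linf : D \subset linf F.
Proof. by rewrite (@D_trace 1 0 0) ?oner_neq0 // subsetIl. Qed.

Lemma infpt_c : infpt c \in D.
Proof. by rewrite infpt_D subrr (GFq0 cardF). Qed.

Lemma first_vertex_D : pt (vec 1 0 0 *m M) \in D.
Proof.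
apply/memD; exists 1, 0; rewrite (GFq1 q F) (GFq0 cardF) oner_eq0.
by split=> //; rewrite mulr0 addr0.
Qed.

Lemma card_D : #|D| = q.+1.
Proof.
have [n1 u1] := (oner_neq0 F, baer_mx_unit 0 0 (oner_neq0 F)).
rewrite (D_trace 0 0 n1) (baer_trace_card ppq cardF u1) ?linf_line //.
rewrite -(D_trace 0 0 n1); apply/card_gt1P; exists (pt (vec 1 0 0 *m M)), (infpt c).
rewrite first_vertex_D infpt_c; split=> //; apply/eqP=> /(eq_fpt uM)-/(_ _ (vecm_neq0 _))[].
  by rewrite vec_eq0 oner_eq0.
move=> a _; rewrite vec_scale => /vec_inj[E1 E2 _]; move/eqP: E1.
by rewrite -[a]mulr1 -E2 mul0r oner_eq0.
Qed.

Lemma subplane_chord B x y : subplane q (lines F) B -> D \subset B ->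
  x != 0 -> y != 0 -> x != y -> hpt x \in affine B -> hpt y \in affine B ->
  x * y \in chord_products.
Proof.
move=> Bs DB x0 y0 xy xB yB; have kxy : hpt x != hpt y by apply: contraNneq xy => /hpt_inj->.
have [L [Z [LL xL yL ZL ZD]]] :=
  subplane_direction Bs DB D_linf card_D (ltnW (q_gt1 cardF)) xB yB kxy.
have Ixy := chord_infpt LL x0 y0 xy xL yL.
have ZE := line_linf_infpt LL Ixy (ex_intro _ x xL) ZL (subsetP D_linf _ ZD).
by rewrite in_set -infpt_D -ZE.
Qed.

(** The products of the two pairs in a splitting of four parameters [x, y, z, w] do not depend
    on the splitting: [(xy)(zw) = (xz)(yw)]. As [1] and [c] are independent over GF(q), the
    unordered pairs [{xy, zw}] and [{xz, yw}] coincide, which forces two parameters to agree. *)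
Lemma pairwise_chords_card (X : {set F}) :
  {in X &, forall x y, x != y -> x * y \in chord_products} -> (#|X| <= 3)%N.
Proof.
move=> XS; rewrite leqNgt; apply/negP=> X4.
have /card_gt0P[x xX] : (0 < #|X|)%N by apply: leq_trans X4.
have /card_gt2P[y [z [w [[yX zX wX] [yz zw wy]]]]] : (2 < #|X :\ x|)%N.
  by rewrite (cardsD1 x) xX in X4.
move: yX zX wX; rewrite !in_setD1 => /andP[yx yX] /andP[zx zX] /andP[wx wX].
have nz a b : a \in X -> b \in X -> a != b -> a != 0.
  move=> aX bX ab; apply: contraNneq chord_products0 => a0; have := XS a b aX bX ab.
  by rewrite a0 mul0r.
have x0 : x != 0 by apply: (nz x y); rewrite // eq_sym.
have y0 : y != 0 by apply: (nz y x).
pose T a := - a / k - c.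
have TG a b : a \in X -> b \in X -> a != b -> T (a * b) \in GFq.
  by move=> aX bX ab; have := XS a b aX bX ab; rewrite in_set.
have T1 := TG x y xX yX; have T2 := TG z w zX wX.
have T3 := TG x z xX zX; have T4 := TG y w yX wX.
have {}T1 := T1 (_ : x != y); have {}T3 := T3 (_ : x != z).
move: T1 T3; rewrite ![x == _]eq_sym => /(_ yx) T1 /(_ zx) T3.
have {}T2 := T2 zw; have {}T4 : T (y * w) \in GFq by apply: T4; rewrite eq_sym.
(* This is [(xy)(zw) = (xz)(yw)] divided by [k ^ 2], with the term [c ^ 2] cancelled. *)
have E : (T (x * y) + T (z * w)) * c + T (x * y) * T (z * w) =
         (T (x * z) + T (y * w)) * c + T (x * z) * T (y * w).
  by rewrite /T; field.
have [E1 E2] := GFq_lin_inj ppq cardF cG (GFqD ppq cardF T1 T2) (GFqM T1 T2)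
  (GFqD ppq cardF T3 T4) (GFqM T3 T4) E.
have /eqP : (T (x * y) - T (x * z)) * (T (x * y) - T (y * w)) = 0.
  have -> : (T (x * y) - T (x * z)) * (T (x * y) - T (y * w)) =
    T (x * y) * T (x * y) - T (x * y) * (T (x * z) + T (y * w)) + T (x * z) * T (y * w) by ring.
  by rewrite -E1 -E2; ring.
have Tinj a b : T a = T b -> a = b by move=> /addIr/(divIf k0)/oppr_inj.
rewrite mulf_eq0 !subr_eq0 => /orP[]/eqP/Tinj.
  by move/(mulfI x0)/eqP; rewrite (negbTE yz).
by rewrite mulrC => /(mulfI y0)/eqP; rewrite eq_sym (negbTE wx).
Qed.

(** The subplane through D and the point at [x] whose scale [l] is chosen to contain the point
    at [y] contains also the point at [z]. *)
Lemma three_chords_collinear x y z : x != y -> x != z -> y != z ->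
  x * y \in chord_products -> x * z \in chord_products -> y * z \in chord_products ->
  exists B, [/\ subplane q (lines F) B, D \subset B &
    [/\ hpt x \in B, hpt y \in B & hpt z \in B]].
Proof.
move=> xy xz yz; rewrite !in_set; set t12 := _ - c; set t13 := _ - c; set t23 := _ - c.
move=> T12 T13 T23.
have nz a b : - (a * b) / k - c \in GFq -> a != 0.
  by move=> aS; apply: contraNneq chord_products0 => a0; move: aS; rewrite in_set a0 mul0r.
have x0 := nz _ _ T12; have z0 : z != 0 by apply: (nz z x); rewrite [z * x]mulrC.
have y0 := nz _ _ T23.
pose l := k / y - k / x; have yx : y - x != 0 by rewrite subr_eq0 eq_sym.
have xy' : x - y != 0 by rewrite subr_eq0.
have l0 : l != 0.
  have -> : l = k * (x - y) / (x * y) by rewrite /l; field; rewrite x0 y0.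
  by rewrite !mulf_neq0 ?invr_neq0 // mulf_neq0.
(* The second coordinates of the points at [z] and [y], measured from the point at [x], have
   ratio [rho]; comparing the three chord directions shows that it lies in GF(q). *)
pose rho := (t23 - t12) / (t23 - t13).
have rhoG : rho \in GFq by apply: GFqM; [|apply: GFqV]; apply: (GFqB ppq cardF).
have rhoE : rho = y * (x - z) / (z * (x - y)).
  have -> : rho = (y * (x - z) / k) / (z * (x - y) / k).
    by rewrite /rho /t12 /t13 /t23; congr (_ / _); ring.
  by field; rewrite k0 xy' z0.
have uN := baer_mx_unit x (k / x) l0.
exists (baer q (baer_mx l x (k / x))); split.
- exact: baer_subplane.
- by rewrite (D_trace x (k / x) l0) subsetIr.
have [G0 G1] := (GFq0 cardF, GFq1 q F).
split; apply/(baerP q uN).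
- exists (vec 0 0 1); rewrite vec_GFq // vec1_neq0 baer_mxE; split=> //.
  by congr (pt (vec _ _ _ *m M)); ring.
- exists (vec t12 1 1); rewrite vec_GFq // vec1_neq0 baer_mxE; split=> //.
  by congr (pt (vec _ _ _ *m M)); rewrite /l /t12; field; rewrite ?k0 ?x0 ?y0.
have rtG : rho * t13 \in GFq by apply: GFqM.
exists (vec (rho * t13) rho 1); rewrite vec_GFq // vec1_neq0 baer_mxE; split=> //.
congr (pt (vec _ _ _ *m M)); rewrite rhoE /l /t13; field; rewrite ?k0 ?x0 ?y0 ?z0 ?xy' //.
Qed.

Lemma infpt_notin_K m : m != 0 -> infpt m \notin K.
Proof.
move=> m0; apply/negP=> mK; have : infpt m \in K :&: linf F by rewrite in_setI mK infpt_linf.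
rewrite K_linf in_set2 => /orP[]/eqP/(eq_fpt uM)-/(_ (vecm_neq0 _)) [].
- by rewrite vec_eq0 oner_eq0.
- by move=> a _; rewrite vec_scale mulr0 => /vec_inj[_ /eqP]; rewrite oner_eq0.
- by rewrite vec_eq0 oner_eq0 andbF.
by move=> a _; rewrite vec_scale mulr0 => /vec_inj[/eqP]; rewrite (negbTE m0).
Qed.

(** A line through [infpt m] pairs the parameters of product [- m k]. *)
Lemma second_point L x m : L \in lines F -> x != 0 -> m != 0 -> hpt x \in L -> infpt m \in L ->
  hpt (- (m * k) / x) \in L.
Proof.
move=> LL x0 m0 xL mL.
have E : vec (- (m * k) / x) (k / (- (m * k) / x)) 1 =
    1 *: vec x (k / x) 1 + (- (x / m) - k / x) *: vec m 1 0.
  by rewrite vec_lin; congr vec; field; rewrite ?oppr_eq0 ?mulf_neq0 ?x0 ?m0.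
by rewrite /hpt E; apply: line_frame_lin; rewrite -?E.
Qed.

(** On a tangent the two parameters paired by [second_point] coincide. *)
Lemma tangent_through L m : L \in tangents K -> infpt m \in L -> m != 0 ->
  exists x, [/\ x != 0, hpt x \in L & x ^+ 2 = - k * m].
Proof.
rewrite in_set => /andP[LL /cards1P[Z LZ]] mL m0.
have : Z \in L :&: K by rewrite LZ set11.
rewrite in_setI => /andP[ZL ZK]; case Zl: (Z \in linf F).
  have Zm : Z != infpt m by apply: contraNneq (infpt_notin_K m0) => <-.
  have Ll := eq_line LL (linf_line F) Zm ZL mL Zl (infpt_linf m).
  have := cards1 Z; rewrite -LZ Ll setIC K_linf cards2 => -[/eqP].
  rewrite eqb0 negbK => /eqP/(eq_fpt uM)[].
  - by rewrite vec_eq0 oner_eq0.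
  - by rewrite vec_eq0 oner_eq0 andbF.
  by move=> a _; rewrite vec_scale mulr0 => /vec_inj[/eqP]; rewrite oner_eq0.
have : Z \in affine K by rewrite in_setD Zl ZK.
rewrite affineK => /imsetP[x x0 ZE]; rewrite in_set in x0; subst Z.
exists x; split=> //; have yL := second_point LL x0 m0 ZL mL.
have y0 : - (m * k) / x != 0 by rewrite mulf_neq0 ?invr_neq0 // oppr_eq0 mulf_neq0.
have := affineK_sub y0; rewrite in_setD => /andP[_ yK].
have : hpt (- (m * k) / x) \in L :&: K by rewrite in_setI yL yK.
rewrite LZ in_set1 => /eqP/hpt_inj xE.
by rewrite expr2 -{1}xE divfK // mulNr mulrC.
Qed.

Lemma tangent_at x : x != 0 ->
  exists L, [/\ L \in tangents K, hpt x \in L & infpt (- (x ^+ 2) / k) \in L].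
Proof.
move=> x0; set m := _ / k; have m0 : m != 0.
  by rewrite mulf_neq0 ?invr_neq0 // oppr_eq0 expf_neq0.
have xm : hpt x != infpt m by apply: contraNneq (hpt_linf x) => ->; apply: infpt_linf.
have [L [LL xL mL]] := exists_line xm; exists L; split=> //; rewrite in_set LL.
apply/cards1P; exists (hpt x); apply/setP=> Z; rewrite in_setI in_set1.
apply/andP/eqP => [[ZL ZK]|->]; last first.
  by split=> //; have := affineK_sub x0; rewrite in_setD => /andP[].
case Zl: (Z \in linf F).
  by case/negP: (infpt_notin_K m0); rewrite -(line_linf_infpt LL mL (ex_intro _ x xL) ZL Zl).
have : Z \in affine K by rewrite in_setD Zl ZK.
rewrite affineK => /imsetP[y y0 ZE]; rewrite in_set in y0; subst Z.
apply/eqP; apply: contraT => yx.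
have yx' : y != x by apply: contraNneq yx => ->.
have := line_linf_infpt LL mL (ex_intro _ x xL) (chord_infpt LL y0 x0 yx' ZL xL) (infpt_linf _).
move/infpt_inj/(divIf k0)/oppr_inj; rewrite expr2 => /(mulIf x0) E.
by rewrite E eqxx in yx'.
Qed.

(** The tangents through [infpt m] are those at the two square roots of [- k m]; they are
    distinct because the order is odd. *)
Lemma external_infpt m : m != 0 -> external K (infpt m) = is_square (- k * m).
Proof.
move=> m0; rewrite /external infpt_notin_K //=; apply/idP/idP.
  move=> /cards2P[L [L' [_ /setP/(_ L)]]]; rewrite in_set in_set2 eqxx orTb => /andP[LT mL].
  have [x [_ _ xE]] := tangent_through LT mL m0.
  by apply/existsP; exists x; rewrite xE.
case/existsP=> e /eqP eE.
have e0 : e != 0.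
  apply: contraNneq m0 => e0; move/eqP: eE; rewrite e0 expr0n /= eq_sym mulf_eq0 oppr_eq0.
  by rewrite (negbTE k0).
have mE x : x ^+ 2 = e ^+ 2 -> - (x ^+ 2) / k = m.
  by move=> ->; rewrite eE; field.
have [L1 [T1 eL1]] := tangent_at e0; rewrite mE // => mL1.
have ne0 : - e != 0 by rewrite oppr_eq0.
have [L2 [T2 eL2]] := tangent_at ne0; rewrite mE ?sqrrN // => mL2.
have [LL1 c1] : L1 \in lines F /\ #|L1 :&: K| == 1%N by move: T1; rewrite in_set => /andP[].
have LL2 : L2 \in lines F by move: T2; rewrite in_set => /andP[].
have hptK x : x != 0 -> hpt x \in K by move=> /affineK_sub; rewrite in_setD => /andP[].
apply/cards2P; exists L1, L2; split.
  apply/eqP=> L12; have /card_gt1P : exists P R : point F,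
      [/\ P \in L1 :&: K, R \in L1 :&: K & P != R].
    exists (hpt e), (hpt (- e)); rewrite !in_setI eL1 {1}L12 eL2 !hptK //; split=> //.
    apply/eqP=> /hpt_inj/eqP; rewrite eq_sym; apply/negP; apply: oppr_neq => //.
    exact: odd_cardF cardF oddq.
  by rewrite (eqP c1).
have hpt_neq_inf x : hpt x != infpt m by apply: contraNneq (hpt_linf x) => ->; apply: infpt_linf.
apply/setP=> L; rewrite in_set in_set2; apply/andP/orP => [[LT mL]|]; last first.
  by case=> /eqP->.
have LL : L \in lines F by move: LT; rewrite in_set => /andP[].
have [x [x0 xL xE]] := tangent_through LT mL m0.
have : x ^+ 2 == e ^+ 2 by rewrite xE eE.
rewrite eqf_sqr => /orP[]/eqP xe; subst x; [left|right]; apply/eqP.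
  exact: eq_line LL LL1 (hpt_neq_inf _) xL mL eL1 mL1.
exact: eq_line LL LL2 (hpt_neq_inf _) xL mL eL2 mL2.
Qed.

Definition square_params : {set F} := [set t | (t \in GFq) && is_square (- k * (c + t))].

Lemma card_external : #|[set P in D | external K P]| = #|square_params|.
Proof.
have g_inj : injective (fun t => infpt (c + t)) by move=> t t' /infpt_inj/addrI.
rewrite -(card_imset _ g_inj); apply: eq_card => Z; rewrite in_set.
apply/andP/imsetP => [[ZD Zext]|[t]]; last first.
  rewrite in_set => /andP[tG sq] ->; rewrite external_infpt ?(addc_neq0 ppq cardF cG) //.
  by rewrite infpt_D addrC addKr.
have [a [b [aG bG ab ZE]]] := (memD Z).1 ZD.
have [b0|b0] := eqVneq b 0.
  move: Zext; rewrite /external => /andP[/negP[]].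
  have : pt (vec 1 0 0 *m M) \in K :&: linf F by rewrite K_linf set21.
  rewrite in_setI => /andP[+ _].
  suff -> : Z = pt (vec 1 0 0 *m M) by [].
  rewrite b0 eqxx orbF in ab; rewrite ZE b0 mulr0 addr0; apply/(eq_fpt uM).
  - by rewrite vec_eq0 (negbTE ab).
  - by rewrite vec_eq0 oner_eq0.
  by exists a; rewrite // vec_scale mulr1 mulr0.
have tG : a / b \in GFq by rewrite GFqM ?GFqV.
have ZE' : Z = infpt (c + a / b).
  rewrite ZE; apply/(eq_fpt uM) => //; first by rewrite vec_eq0 (negbTE b0) andbF.
  by exists b; rewrite // vec_scale mulr0 mulr1; congr vec; field.
exists (a / b) => //; rewrite in_set tG /= -external_infpt ?(addc_neq0 ppq cardF cG) //.
by rewrite -ZE'.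
Qed.

Lemma prod_param_inj : injective (fun t => - k * (c + t)).
Proof. by move=> t t' /mulfI; rewrite oppr_eq0 => /(_ k0)/addrI. Qed.

Lemma chord_products_image : chord_products = [set - k * (c + t) | t in [set t in GFq]].
Proof.
apply/setP=> a; rewrite in_set; apply/idP/imsetP => [aS|[t tG ->]].
  by exists (- a / k - c); rewrite ?in_set //; field.
by move: tG; rewrite in_set; have -> : - (- k * (c + t)) / k - c = t by field.
Qed.

Lemma card_chord_products : #|chord_products| = q.
Proof. by rewrite chord_products_image card_imset ?(card_GFq cardF) //; apply: prod_param_inj. Qed.

Lemma card_chord_products_square : #|[set a in chord_products | is_square a]| = #|square_params|.
Proof.
rewrite -(card_imset square_params prod_param_inj); apply: eq_card => a.
rewrite in_set chord_products_image.
apply/andP/imsetP => [[/imsetP[t tG ->] sq]|[t]].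
  by exists t; rewrite // in_set sq andbT; rewrite in_set in tG.
by rewrite in_set => /andP[tG sq] ->; split=> //; apply/imsetP; exists t; rewrite ?in_set.
Qed.

Lemma new_line_chord L x y : L \in new_lines q D -> x != 0 -> y != 0 -> x != y ->
  hpt x \in L -> hpt y \in L -> x * y \in chord_products.
Proof. by case/imsetP=> B; rewrite in_set => /andP[Bs DB] ->; apply: subplane_chord. Qed.

Lemma no_three_old_line L x y z : L \in old_lines D -> x != 0 -> y != 0 -> z != 0 ->
  x != y -> x != z -> y != z -> hpt x \in L -> hpt y \in L -> hpt z \in L -> False.
Proof.
case/imsetP=> L'; rewrite in_set => /andP[LL _] -> x0 y0 z0 xy xz yz.
rewrite !in_setD => /andP[_ xL] /andP[_ yL] /andP[_ zL].
exact: (no_three_collinear LL x0 y0 z0).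
Qed.

Lemma trace_params (A : {set point F}) : A \subset affine K ->
  A = hpt @: [set x | (x != 0) && (hpt x \in A)].
Proof.
move=> AK; apply/setP=> Z; apply/idP/imsetP => [ZA|[x]]; last by rewrite in_set => /andP[_ +] ->.
have := subsetP AK Z ZA; rewrite affineK => /imsetP[x x0 ZE]; exists x => //.
by rewrite !in_set in x0 *; rewrite x0 -ZE.
Qed.

Lemma hall_line_bound L : L \in hall_lines q D -> (#|L :&: affine K| <= 3)%N.
Proof.
move=> LH; rewrite [_ :&: _]trace_params ?subsetIr // card_imset; last exact: hpt_inj.
set X := [set x | _].
have XP x : x \in X -> x != 0 /\ hpt x \in L.
  by rewrite in_set in_setI => /and3P[].
case/setUP: LH => Lo; last first.
  apply: pairwise_chords_card => x y /XP[x0 xL] /XP[y0 yL] xy.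
  exact: (new_line_chord Lo).
apply: leqW; rewrite leqNgt; apply/negP=> /card_gt2P[x [y [z [[xX yX zX] [xy yz zx]]]]].
have [x0 xL] := XP x xX; have [y0 yL] := XP y yX; have [z0 zL] := XP z zX.
by apply: (no_three_old_line Lo x0 y0 z0); rewrite // eq_sym.
Qed.

(** On a new line all chords meet D; a third point on an old line is excluded by
    [no_three_old_line]. *)
Lemma hall_triplesE :
  collinear_triples (hall_lines q D) (affine K) =
  [set hpt @: (X : {set F}) | X in product_triples chord_products].
Proof.
apply/setP=> t; rewrite in_set; apply/and3P/imsetP => [[tK /eqP ct /exists_inP[L LH tL]]|[X]].
  have tE := trace_params tK; move: tE; set X := [set x | _] => tE.
  have cX : #|X| = 3%N by rewrite -ct tE card_imset //; apply: hpt_inj.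
  have XP x : x \in X -> x != 0 /\ hpt x \in L.
    by rewrite in_set => /andP[x0 xt]; split=> //; apply: (subsetP tL).
  exists X => //; rewrite in_set cX eqxx /=.
  apply/forall_inP=> x xX; apply/forall_inP=> y yX; apply/implyP=> xy.
  have [x0 xL] := XP x xX; have [y0 yL] := XP y yX.
  case/setUP: LH => Lo; last exact: (new_line_chord Lo).
  have [z [zX zx zy _]] := cards3_pick cX xX yX xy; have [z0 zL] := XP z zX.
  by case: (no_three_old_line Lo x0 y0 z0); rewrite // eq_sym.
rewrite in_set => /andP[/eqP cX /forall_inP XS] ->.
have {}XS x y : x \in X -> y \in X -> x != y -> x * y \in chord_products.
  by move=> xX yX; have /forall_inP/(_ y yX)/implyP := XS x xX.
have /card_gt2P[x [y [_ [[xX yX _] [xy _ _]]]]] : (2 < #|X|)%N by rewrite cX.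
have [z [zX zx zy XE]] := cards3_pick cX xX yX xy.
have xz : x != z by rewrite eq_sym.
have yz : y != z by rewrite eq_sym.
have nz a b : a \in X -> b \in X -> a != b -> a != 0.
  move=> aX bX ab; apply: contraNneq chord_products0 => a0; have := XS a b aX bX ab.
  by rewrite a0 mul0r.
split.
- apply/subsetP=> _ /imsetP[a aX ->]; apply: affineK_sub.
  have [ax|ax] := eqVneq a x; last exact: (nz a x).
  by apply: (nz a y); rewrite ?ax.
- by rewrite card_imset ?cX //; apply: hpt_inj.
have [B [Bs DB [xB yB zB]]] := 
  three_chords_collinear xy xz yz (XS _ _ xX yX xy) (XS _ _ xX zX xz) (XS _ _ yX zX yz).
apply/exists_inP; exists (affine B).
  by apply/setUP; right; apply/imsetP; exists B; rewrite // in_set Bs DB.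
apply/subsetP=> _ /imsetP[a aX ->]; rewrite in_setD hpt_linf /=.
by move: aX; rewrite XE !in_setU !in_set1 => /orP[/orP[]|] /eqP->.
Qed.

Lemma card_hall_triples (s := #|[set P in D | external K P]|) :
  #|collinear_triples (hall_lines q D) (affine K)| = (2 * s * 'C(q - s, 2) + 2 * 'C(s, 3))%N.
Proof.
rewrite hall_triplesE card_imset; last exact: (imset_inj hpt_inj).
rewrite (card_product_triples chord_products0 (odd_cardF cardF oddq)).
rewrite card_chord_products_square -card_external -/s.
suff -> : #|[set a in chord_products | ~~ is_square a]| = (q - s)%N by [].
rewrite -card_chord_products -(cardsID [set a | is_square a] chord_products) /s card_external.
rewrite -card_chord_products_square.
have -> : chord_products :&: [set a | is_square a] = [set a in chord_products | is_square a].
  by apply/setP=> a; rewrite !in_set.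
by rewrite addKn; apply: eq_card => a; rewrite !in_set andbC.
Qed.

Lemma external_count (s := #|[set P in D | external K P]|) :
  s = ((q - 1)./2)%N \/ s = ((q + 1)./2)%N.
Proof. by rewrite /s card_external; apply: card_square_scaled; rewrite // oppr_eq0. Qed.
End MixedFrame.

(** * Asymptotics and the theorem *)

Lemma bin2_mul n : ('C(n, 2) * 2 = n * n.-1)%N.
Proof. by rewrite -[2%N]/(2`!) bin_ffact !ffactnS ffactn0 muln1. Qed.

Lemma bin3_mul n : ('C(n, 3) * 6 = n * (n.-1 * n.-2))%N.
Proof. by rewrite -[6%N]/(3`!) bin_ffact !ffactnS ffactn0 muln1. Qed.

(** Both values of [s] give a cubic polynomial in [m = (q - 1) / 2], stated without division. *)
Lemma hall_count_poly (q s : nat) : (5 < q)%N -> odd q ->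
  s = ((q - 1)./2)%N \/ s = ((q + 1)./2)%N ->
  let N := (2 * s * 'C(q - s, 2) + 2 * 'C(s, 3))%N in
  exists m, [/\ (3 <= m)%N, q = m.*2.+1 &
    (3 * N = 2 * m * (2 * m ^ 2 + 1) \/ 3 * N + 4 * m = 4 * m ^ 3)%N].
Proof.
move=> q5 oq sE N; exists q./2; have qE : q = q./2.*2.+1.
  by rewrite -[LHS]odd_double_half oq.
move: (q./2) qE => m qE.
have m3 : (3 <= m)%N by move: q5; rewrite qE -muln2; lia.
have h1 : ((m.*2.+1 - 1)./2 = m)%N by rewrite subn1 /= doubleK.
have h2 : ((m.*2.+1 + 1)./2 = m.+1)%N by rewrite addn1 -doubleS doubleK.
split=> //; move: sE; rewrite /N qE h1 h2.
have b2 := bin2_mul; have b3 := bin3_mul.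
case=> ->; [left|right].
  have -> : (m.*2.+1 - m = m.+1)%N by rewrite -addnn; lia.
  have := b2 m.+1; have := b3 m; rewrite /=.
  move: m3; case: m {qE h1 h2} => [|[|m]] //= _; set u := 'C(_, _); set v := 'C(_, _); lia.
have -> : (m.*2.+1 - m.+1 = m)%N by rewrite -addnn; lia.
have := b2 m; have := b3 m.+1; rewrite /=.
move: m3; case: m {qE h1 h2} => [|[|m]] //= _; set u := 'C(_, _); set v := 'C(_, _); lia.
Qed.

Theorem theorem7p3 :
  (forall (q : nat) (F : finFieldType) (D K : {set point F}),
     (5 < q)%N -> odd q -> mixed_hyperbola q D K ->
     let s := #|[set P in D | external K P]| in
     [/\ ~~ is_arc (hall_lines q D) (affine K),
         forall L : {set point F}, L \in hall_lines q D ->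
           (#|L :&: affine K| <= 3)%N,
         s = ((q - 1)./2)%N \/ s = ((q + 1)./2)%N
       & #|collinear_triples (hall_lines q D) (affine K)|
         = (2 * s * 'C(q - s, 2) + 2 * 'C(s, 3))%N])
  /\
  (exists q0 : nat, forall (q : nat) (F : finFieldType) (D K : {set point F}),
     (5 < q)%N -> odd q -> mixed_hyperbola q D K -> (q0 <= q)%N ->
     let N : rat := #|collinear_triples (hall_lines q D) (affine K)|%:R in
     let approx : rat := 7 * q%:R ^+ 3 / 48 in
     `|N - approx| <= approx / 7)
  /\
  (forall eps : rat, 0 < eps ->
   exists q0 : nat, forall (q : nat) (F : finFieldType) (D K : {set point F}),
     (5 < q)%N -> odd q -> mixed_hyperbola q D K -> (q0 <= q)%N ->
     let N : rat := #|collinear_triples (hall_lines q D) (affine K)|%:R in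
     N <= eps * 'C(#|affine K|, 3)%:R).
Proof.
have main (q : nat) (F : finFieldType) (D K : {set point F}) :
    (5 < q)%N -> odd q -> mixed_hyperbola q D K ->
    [/\ forall L : {set point F}, L \in hall_lines q D -> (#|L :&: affine K| <= 3)%N,
      #|affine K| = (q ^ 2 - 1)%N &
      let s := #|[set P in D | external K P]| in
      (s = ((q - 1)./2)%N \/ s = ((q + 1)./2)%N)
       /\ #|collinear_triples (hall_lines q D) (affine K)|
         = (2 * s * 'C(q - s, 2) + 2 * 'C(s, 3))%N].
  move=> q5 oq H; have [ppq cF _ _ _] := H.
  have [M [c [k [uM cG k0 ml [Kl mD mK]]]]] := mixed_frame ppq cF H.
  split.
  - exact: (hall_line_bound ppq cF uM cG k0 ml mD mK).
  - exact: (card_affineK cF uM k0 ml mK).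
  split; first exact: (external_count ppq cF oq uM cG k0 ml Kl mD mK).
  exact: (card_hall_triples ppq cF oq uM cG k0 ml Kl mD mK).
have count (q : nat) (F : finFieldType) (D K : {set point F}) :
    (5 < q)%N -> odd q -> mixed_hyperbola q D K ->
    let N := #|collinear_triples (hall_lines q D) (affine K)| in
    exists m, [/\ (3 <= m)%N, q = m.*2.+1 &
      (3 * N = 2 * m * (2 * m ^ 2 + 1) \/ 3 * N + 4 * m = 4 * m ^ 3)%N].
  move=> q5 oq H; have [_ _ [sE ->]] := main q F D K q5 oq H.
  exact: hall_count_poly.
split; [|split].
- move=> q F D K q5 oq H s; have [bound _ [sE NE]] := main q F D K q5 oq H; split=> //.
  apply/negP=> /eqP arc; have [m [m3 _]] := count q F D K q5 oq H.
  rewrite arc cards0; case; nia.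
(* [q ^ 3 / 8 <= N] holds from [q = 13] on. *)
- exists 13%N => q F D K q5 oq H q13; cbv zeta; set N : rat := #|_|%:R.
  have [m [_ qE NE]] := count q F D K q5 oq H.
  have m6 : (6 <= m)%N by move: q13; rewrite qE -muln2; lia.
  pose x : rat := m%:R; have x6 : 6 <= x by rewrite /x (ler_nat _ 6).
  have xx : 6 * x <= x ^+ 2 by rewrite expr2 ler_wpM2r //; lra.
  have xxx : 6 * x ^+ 2 <= x ^+ 3 by rewrite [x ^+ 3]exprS ler_wpM2r //; lra.
  have yE : q%:R = 2 * x + 1 :> rat by rewrite qE -muln2 -addn1 natrD natrM mulrC.
  have NE' : 3 * N = 2 * x * (2 * x ^+ 2 + 1) \/ 3 * N + 4 * x = 4 * x ^+ 3.
    by case: NE => /(congr1 (fun n => n%:R : rat)) E; [left|right]; move: E;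
      rewrite !(natrD, natrM, natrX).
  rewrite yE ler_norml; case: NE' => E; apply/andP; split; lra.
(* [N <= q ^ 3 / 6], while the binomial coefficient is at least [q ^ 6 / 48]. *)
move=> eps eps0; exists (Num.bound (8 / eps)) => q F D K q5 oq H qb.
cbv zeta; set N : rat := #|_|%:R.
have [m [m3 qE NE]] := count q F D K q5 oq H.
have [_ -> _] := main q F D K q5 oq H.
pose y : rat := q%:R; pose x : rat := m%:R.
have y7 : 6 <= y by rewrite /y (ler_nat _ 6).
have yeps : 8 <= eps * y.
  rewrite mulrC -ler_pdivrMr //; apply: le_trans (ltW (archi_boundP _)) _.
    by rewrite divr_ge0 ?(ltW eps0).
  by rewrite /y ler_nat.
have yE : y = 2 * x + 1 by rewrite /y qE -muln2 -addn1 natrD natrM mulrC.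
have x3 : 3 <= x by rewrite /x (ler_nat _ 3).
have NE' : 3 * N = 2 * x * (2 * x ^+ 2 + 1) \/ 3 * N + 4 * x = 4 * x ^+ 3.
  by case: NE => /(congr1 (fun n => n%:R : rat)) E; [left|right]; move: E;
    rewrite !(natrD, natrM, natrX).
have N6 : 6 * N <= y ^+ 3.
  have x2 : 0 <= x ^+ 2 by rewrite sqr_ge0.
  by rewrite yE; case: NE' => E; lra.
have [j jE] : exists j, (q ^ 2 = j.+3)%N.
  by exists (q ^ 2 - 3)%N; rewrite -addn3 subnK // -[3%N]/(3 * 1)%N; nia.
pose z : rat := j%:R; have zE : y ^+ 2 = z + 3.
  by rewrite -natrX jE -addn3 natrD.
have B6 : 6 * 'C(q ^ 2 - 1, 3)%:R = (z + 2) * ((z + 1) * z).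
  have := bin3_mul j.+2; rewrite /= => /(congr1 (fun n => n%:R : rat)).
  have e2 : j.+2%:R = z + 2 :> rat by rewrite -addn2 natrD.
  have e1 : j.+1%:R = z + 1 :> rat by rewrite -addn1 natrD.
  by rewrite jE subn1 /= !natrM e2 e1 mulrC.
have zy : y ^+ 2 <= 2 * z by nra.
have z0 : 0 <= z by rewrite ler0n.
have z3 : y ^+ 6 <= 8 * z ^+ 3.
  have -> : y ^+ 6 = (y ^+ 2) ^+ 3 by rewrite -exprM.
  have -> : 8 * z ^+ 3 = (2 * z) ^+ 3 by ring.
  by rewrite lerXn2r ?nnegrE ?sqr_ge0 // mulr_ge0.
have B6' : z ^+ 3 <= 6 * 'C(q ^ 2 - 1, 3)%:R.
  rewrite B6; have -> : (z + 2) * ((z + 1) * z) = z ^+ 3 + (3 * z ^+ 2 + 2 * z) by ring.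
  by rewrite lerDl addr_ge0 ?mulr_ge0 ?exprn_ge0.
have step : 8 * y ^+ 3 <= eps * y ^+ 6.
  have -> : eps * y ^+ 6 = eps * y * y ^+ 2 * y ^+ 3 by ring.
  apply: ler_wpM2r; first by rewrite exprn_ge0 // (le_trans _ y7).
  by nra.
have : eps * y ^+ 6 <= eps * (8 * (6 * 'C(q ^ 2 - 1, 3)%:R)).
  by rewrite ler_pM2l //; lra.
move: N6 step; set b := 'C(_, _)%:R; lra.
Qed.
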